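(* Let $f$ be either $\gamma$ or $i$. Suppose $\mathcal{G}$ is a hereditary class of graphs such that whenever $G\in\mathcal{G}$ has at least one edge, there is a vertex $v$ of $G$ with $f(G)\le f(G-v)$. Then for every $G\in\mathcal{G}$ with $n$ vertices, $\operatorname{pd}(G)\le n-f(G)$. If $f=i$, then for every $G\in\mathcal{G}$ with $n$ vertices, \[\operatorname{pd}(G)=n-i(G)=\operatorname{bight}(I(G)),\] and $S/I(G)$ is Cohen–Macaulay if and only if it is unmixed.
   Context: All graphs are finite and simple. A class of graphs is hereditary if it is closed under deleting a vertex (passing to the induced subgraph on the remaining vertices). A set $A\subseteq V(G)$ is dominating if every vertex not in $A$ has a neighbor in $A$; $\gamma(G)$ is the minimum size of a dominating set and $i(G)$ the minimum size of an independent dominating set ($\gamma=i=0$ for the empty graph). For $G$ with vertex set $\{x_1,\dots,x_n\}$ and a fixed field $\mathbf{k}$, $S=\mathbf{k}[x_1,\dots,x_n]$, $I(G)$ is the edge ideal generated by $x_ix_j$ over edges $(x_i,x_j)$, $\operatorname{pd}(G)$ is the projective dimension of $S/I(G)$, and $\operatorname{bight}(I(G))$ (big height) is the maximum height of a minimal prime of $I(G)$, equivalently the maximum size of a minimal vertex cover of $G$. $S/I(G)$ is unmixed if all minimal primes (equivalently, all associated primes) of $I(G)$ have the same height. *)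

(* Defs.v *)
From HB Require Import structures.
From mathcomp Require Import all_boot all_order all_algebra.
From mathcomp Require Import mpoly.

Set Implicit Arguments.
Unset Strict Implicit.
Unset Printing Implicit Defensive.

Import GRing.Theory.
Local Open Scope ring_scope.

Definition simple_graph (n : nat) (e : rel 'I_n) : Prop :=
  (forall a b, e a b = e b a) /\ (forall a, e a a = false).

(* G - v : the induced subgraph on the vertices other than v, relabelled
   by the order-preserving bijection lift v : 'I_n -> 'I_n.+1 \ {v}. *)
Definition del_vertex (n : nat) (e : rel 'I_n.+1) (v : 'I_n.+1) : rel 'I_n :=
  fun a b => e (lift v a) (lift v b).

Definition has_edge (n : nat) (e : rel 'I_n) : Prop := exists a b, e a b.

Definition dominating (n : nat) (e : rel 'I_n) (A : {set 'I_n}) : bool :=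
  [forall x, (x \notin A) ==> [exists y in A, e x y]].

Definition independent (n : nat) (e : rel 'I_n) (A : {set 'I_n}) : bool :=
  [forall x in A, forall y in A, ~~ e x y].

(* gamma(G): minimum size of a dominating set (the whole vertex set is
   dominating, so the default value n is never the answer unless it is
   the true minimum). *)
Definition gamma (n : nat) (e : rel 'I_n) : nat :=
  \big[minn/n]_(A : {set 'I_n} | dominating e A) #|A|.

(* i(G): minimum size of an independent dominating set (maximal
   independent sets exist and have size <= n). *)
Definition idom (n : nat) (e : rel 'I_n) : nat :=
  \big[minn/n]_(A : {set 'I_n} | independent e A && dominating e A) #|A|.

Section Alg.
Variables (F : fieldType) (n : nat).
Local Notation S := {mpoly F[n]}.

Definition in_ideal (gs : seq S) (p : S) : Prop :=
  exists c : 'I_(size gs) -> S, p = \sum_(i < size gs) c i * gs`_i.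

Definition ideal_add (J : S -> Prop) (gs : seq S) (p : S) : Prop :=
  exists q, J q /\ in_ideal gs (p - q).

Definition var_list : seq S := [seq 'X_i | i <- enum 'I_n].

Definition edge_gens (e : rel 'I_n) : seq S :=
  [seq 'X_(p.1) * 'X_(p.2) | p <- enum [pred p : 'I_n * 'I_n | e p.1 p.2]].

Definition edge_ideal (e : rel 'I_n) : S -> Prop := in_ideal (edge_gens e).

(* A free resolution of S/J of length <= r:
     ... -> S^(b 2) --d 1--> S^(b 1) --d 0--> S^(b 0) --c--> S/J -> 0
   (row-vector convention, u |-> u *m d i), with b i = 0 for i > r,
   exact everywhere. The augmentation sends u to the class of u *m c. *)
Record free_resolution (J : S -> Prop) (r : nat) := FreeRes {
  fr_rank : nat -> nat;
  fr_diff : forall i, 'M[S]_(fr_rank i.+1, fr_rank i);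
  fr_aug  : 'cV[S]_(fr_rank 0);
  fr_len  : forall i, (r < i)%N -> fr_rank i = 0%N;
  fr_surj : forall p : S, exists u : 'rV[S]_(fr_rank 0),
              J (p - (u *m fr_aug) 0 0);
  fr_exact0 : forall u : 'rV[S]_(fr_rank 0),
              J ((u *m fr_aug) 0 0) <->
              exists w : 'rV[S]_(fr_rank 1), u = w *m fr_diff 0;
  fr_exact : forall i (u : 'rV[S]_(fr_rank i.+1)),
              u *m fr_diff i = 0 <->
              exists w : 'rV[S]_(fr_rank i.+2), u = w *m fr_diff i.+1
}.

Definition has_free_res (J : S -> Prop) (r : nat) : Prop :=
  exists R : free_resolution J r, True.

Definition is_pd (J : S -> Prop) (d : nat) : Prop :=
  has_free_res J d /\ forall r, has_free_res J r -> (d <= r)%N.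

Definition is_ideal (P : S -> Prop) : Prop :=
  P 0 /\ (forall a b, P a -> P b -> P (a + b)) /\
  (forall r a, P a -> P (r * a)).

Definition is_prime (P : S -> Prop) : Prop :=
  is_ideal P /\ ~ P 1 /\ (forall a b, P (a * b) -> P a \/ P b).

Definition subideal (P Q : S -> Prop) : Prop := forall x, P x -> Q x.

Definition strict_subideal (P Q : S -> Prop) : Prop :=
  subideal P Q /\ exists x, Q x /\ ~ P x.

Definition prime_chain (Ps : nat -> S -> Prop) (l : nat) : Prop :=
  (forall i, (i <= l)%N -> is_prime (Ps i)) /\
  (forall i, (i < l)%N -> strict_subideal (Ps i) (Ps i.+1)).

Definition height_is (P : S -> Prop) (h : nat) : Prop :=
  (exists Ps, prime_chain Ps h /\ (forall x, Ps h x <-> P x)) /\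
  (forall Ps l, prime_chain Ps l -> (forall x, Ps l x <-> P x) -> (l <= h)%N).

Definition dim_is (J : S -> Prop) (d : nat) : Prop :=
  (exists Ps, prime_chain Ps d /\ subideal J (Ps 0)) /\
  (forall Ps l, prime_chain Ps l -> subideal J (Ps 0) -> (l <= d)%N).

Definition minimal_prime (J P : S -> Prop) : Prop :=
  is_prime P /\ subideal J P /\
  forall Q, is_prime Q -> subideal J Q -> subideal Q P -> subideal P Q.

Definition bight_is (J : S -> Prop) (b : nat) : Prop :=
  (exists P, minimal_prime J P /\ height_is P b) /\
  (forall P h, minimal_prime J P -> height_is P h -> (h <= b)%N).

Definition unmixed (J : S -> Prop) : Prop :=
  forall P Q hP hQ, minimal_prime J P -> minimal_prime J Q ->
    height_is P hP -> height_is Q hQ -> hP = hQ.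

Definition regular_seq (J : S -> Prop) (fs : seq S) : Prop :=
  (forall f, f \in fs -> in_ideal var_list f) /\
  (forall k, (k < size fs)%N -> forall g : S,
     ideal_add J (take k fs) (fs`_k * g) -> ideal_add J (take k fs) g) /\
  ~ ideal_add J fs 1.

Definition depth_is (J : S -> Prop) (d : nat) : Prop :=
  (exists fs, regular_seq J fs /\ size fs = d) /\
  (forall fs, regular_seq J fs -> (size fs <= d)%N).

Definition cohen_macaulay (J : S -> Prop) : Prop :=
  exists d, depth_is J d /\ dim_is J d.

End Alg.

(* Main.v *)
From HB Require Import structures.
From Stdlib Require Import FunctionalExtensionality PropExtensionality.
From Stdlib Require Import Classical ClassicalEpsilon.
Require Import Defs.
From mathcomp Require Import all_boot all_order all_algebra.
From mathcomp Require Import mpoly.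
From mathcomp Require Import ring zify.

(** For a variable x = x_v of an edge ideal I, both I : x and I + (x) are again
    edge ideals of induced subgraphs plus some variables, on G - N[v] and G - v.
    The exact sequence 0 -> S/(I:x) -> S/I -> S/(I+x) -> 0 propagates two
    properties from its ends to the middle: having a free resolution of length
    at most r (horseshoe lemma), and regularity of a given sequence.  Since
    f(G) <= f(G - v) and f(G) <= f(G - N[v]) + 1, induction reduces both to
    ideals (x_T) generated by variables.  For the first this gives
    pd(G) <= n - f(G).  For the second we use the elementary symmetric
    polynomials e_1, ..., e_k, which are regular modulo every (x_T) with
    |T| <= n - k, over any field; hence e_1, ..., e_f(G) is S/I-regular.

    Let W be an independent dominating set and T its complement, so that (x_T)
    is the annihilator of the monomial x_W in S/I.  Chasing x_W through a free
    resolution modulo initial segments of x_T shows that the resolution has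
    length at least |T|.  If f_1, ..., f_d is S/I-regular in the maximal ideal,
    the Koszul homology H_i(q; S/I) of any q generating an ideal primary to the
    maximal ideal vanishes for i > n - d; taking for q the x_t (t in T) and the
    x_w^2 (w in W), the class of x_W e_T is nonzero in degree |T|, so
    d <= n - |T|.

    Heights and dimensions come from the bound n on the length of prime chains:
    if y_i lies in P_(i+1) but not in P_i, the monomials in the y_i are linearly
    independent modulo P_0, and n + 1 polynomials in n variables are
    algebraically dependent by counting. *)

Set Implicit Arguments.
Unset Strict Implicit.
Unset Printing Implicit Defensive.

Import GRing.Theory.
Local Open Scope ring_scope.

(** * Ideals as predicates *)

Lemma pred_ext (T : Type) (P Q : T -> Prop) : (forall x, P x <-> Q x) -> P = Q.
Proof.
by move=> h; apply: functional_extensionality => x; apply: propositional_extensionality.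
Qed.

Section IdealCalculus.
Variables (F : fieldType) (n : nat).
Local Notation S := {mpoly F[n]}.
Implicit Types (J K : S -> Prop) (x y f g p q : S) (fs gs : seq S).

Definition adj J x : S -> Prop := fun p => exists q, J (p - x * q).
Definition colon J x : S -> Prop := fun p => J (x * p).
Definition nzd J x := forall g, J (x * g) -> J g.

(** Weak regularity: the final quotient may be zero. The recursion passes from [J] to J + (f), the
    form in which the arguments with [colon] and [adj] induct; properness is checked separately in
    [esyms_regular_seq]. *)
Fixpoint regular J fs : Prop :=
  if fs is f :: fs' then nzd J f /\ regular (adj J f) fs' else True.

Lemma ideal0 J : is_ideal J -> J 0.
Proof. by case. Qed.

Lemma idealD J p q : is_ideal J -> J p -> J q -> J (p + q).
Proof. by case=> _ [hD _]; apply: hD. Qed.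

Lemma idealM J p q : is_ideal J -> J q -> J (p * q).
Proof. by case=> _ [_ hM]; apply: hM. Qed.

Lemma idealMr J p q : is_ideal J -> J p -> J (p * q).
Proof. by move=> hJ hp; rewrite mulrC; apply: idealM. Qed.

Lemma idealN J p : is_ideal J -> J p -> J (- p).
Proof. by move=> hJ hp; rewrite -mulN1r; apply: idealM. Qed.

Lemma idealB J p q : is_ideal J -> J p -> J q -> J (p - q).
Proof. by move=> hJ hp hq; apply: idealD => //; apply: idealN. Qed.

Lemma ideal_trans J p q : is_ideal J -> J q -> J (p - q) -> J p.
Proof. by move=> hJ hq hpq; rewrite -[p](subrK q); apply: idealD. Qed.

Lemma ideal_sum J (I : Type) (r : seq I) (P : pred I) (h : I -> S) :
  is_ideal J -> (forall i, P i -> J (h i)) -> J (\sum_(i <- r | P i) h i).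
Proof.
move=> hJ hh; apply: (big_ind J) => //; first exact: ideal0.
by move=> p q; apply: idealD.
Qed.

Lemma adj_ideal J x : is_ideal J -> is_ideal (adj J x).
Proof.
move=> hJ; split; [|split].
- by exists 0; rewrite mulr0 subr0; apply: ideal0.
- move=> a b [q hq] [r hr]; exists (q + r).
  by rewrite mulrDr opprD addrACA; apply: idealD.
- move=> r a [q hq]; exists (r * q).
  by rewrite mulrCA -mulrBr; apply: idealM.
Qed.

Lemma sub_adj J x p : J p -> adj J x p.
Proof. by move=> hp; exists 0; rewrite mulr0 subr0. Qed.

Lemma adj_gen J x : is_ideal J -> adj J x x.
Proof. by move=> hJ; exists 1; rewrite mulr1 subrr; apply: ideal0. Qed.

Lemma adj_sub J K x :
  is_ideal K -> subideal J K -> K x -> subideal (adj J x) K.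
Proof.
move=> hK hJK hx p [q hq]; apply: (@ideal_trans _ _ (x * q)) => //.
  exact: idealMr.
exact: hJK.
Qed.

Lemma adjC J x y : adj (adj J x) y = adj (adj J y) x.
Proof.
apply: pred_ext => p; split=> [] [q [r h]]; exists r, q; by rewrite addrAC.
Qed.

Lemma nzd_adj J x f :
  is_ideal J -> nzd J x -> nzd (adj J x) f -> nzd (adj J f) x.
Proof.
move=> hJ hx hf g [h hh].
have [|h' hh'] := hf h.
  by exists g; rewrite -opprB; apply: idealN.
exists h'; apply: hx.
rewrite mulrBr (_ : _ - _ = (x * g - f * h) + f * (h - x * h')).
  by apply: idealD => //; apply: idealM.
by rewrite mulrBr addrA subrK mulrCA.
Qed.

(** Since f is a nonzerodivisor on S/(J + x), the sequence 0 -> S/(J:x) -> S/J -> S/(J+x) -> 0 stays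
    exact modulo f; the equality identifies its left end after the reduction. *)
Lemma colon_adj J x f :
  is_ideal J -> nzd (adj J x) f -> colon (adj J f) x = adj (colon J x) f.
Proof.
move=> hJ hf; apply: pred_ext => g; split; last first.
  by case=> h hh; exists (x * h); rewrite mulrCA -mulrBr.
case=> h hh; have [|h' hh'] := hf h.
  by exists g; rewrite -opprB; apply: idealN.
exists h'; rewrite /colon mulrBr.
rewrite (_ : _ - _ = (x * g - f * h) + f * (h - x * h')).
  by apply: idealD => //; apply: idealM.
by rewrite mulrBr addrA subrK mulrCA.
Qed.

Lemma nzd_from_colon J x f :
  is_ideal J -> nzd (colon J x) f -> nzd (adj J x) f -> nzd J f.
Proof.
move=> hJ h1 h2 g hg; have [h hh] := h2 g (sub_adj x hg).
apply: (@ideal_trans _ _ (x * h)) => //; apply: h1.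
rewrite /colon mulrCA (_ : f * _ = f * g - f * (g - x * h)).
  by apply: idealB => //; apply: idealM.
by rewrite mulrBr opprB addrCA subrr addr0.
Qed.

(** A nonzerodivisor on both ends of the exact sequence is one on the middle term. By [colon_adj]
    the sequence for J + (f) has the expected ends, so the argument repeats along [fs]. *)
Lemma regular_from_colon J x fs :
  is_ideal J -> regular (colon J x) fs -> regular (adj J x) fs ->
  regular J fs.
Proof.
elim: fs J => //= f fs IH J hJ [h1 h1'] [h2 h2']; split.
  exact: nzd_from_colon h1 h2.
apply: IH; first exact: adj_ideal.
- by rewrite colon_adj.
- by rewrite adjC.
Qed.

Lemma regular_rcons J fs f :
  regular J (rcons fs f) <-> regular J fs /\ nzd (foldl adj J fs) f.
Proof.
elim: fs J => [|g fs IH] J /=; first by tauto.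
by rewrite IH; tauto.
Qed.

Lemma regular_cat J fs gs : regular J (fs ++ gs) -> regular J fs.
Proof. by elim: fs J => [|f fs IH] J //= [h /IH]. Qed.

Lemma foldl_adj_ideal J fs : is_ideal J -> is_ideal (foldl adj J fs).
Proof. by elim: fs J => [|f fs IH] J //= hJ; apply/IH/adj_ideal. Qed.

Lemma foldl_sub_adj J fs : subideal J (foldl adj J fs).
Proof.
by elim: fs J => [|f fs IH] J p //= hp; apply/IH/sub_adj.
Qed.

Lemma foldl_adj_sub J K fs :
  is_ideal K -> subideal J K -> (forall f, f \in fs -> K f) ->
  subideal (foldl adj J fs) K.
Proof.
move=> hK; elim: fs J => //= f fs IH J hJK hfs; apply: IH.
  by apply: adj_sub => //; apply: hfs; rewrite mem_head.
by move=> g hg; apply: hfs; rewrite inE hg orbT.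
Qed.

Lemma in_ideal_nil p : in_ideal [::] p <-> p = 0.
Proof.
split=> [[c ->]|->]; first by rewrite big_ord0.
by exists (fun=> 0); rewrite big_ord0.
Qed.

Lemma in_ideal_cons f fs p :
  in_ideal (f :: fs) p <-> exists q, in_ideal fs (p - f * q).
Proof.
split.
  case=> c ->; rewrite big_ord_recl /=.
  exists (c ord0); exists (fun i => c (lift ord0 i)).
  by rewrite mulrC addrC addKr.
case=> q [c hc].
exists (fun i => if unlift ord0 i is Some j then c j else q).
rewrite big_ord_recl unlift_none /= mulrC -[LHS](subrK (f * q)) addrC hc.
by congr (_ + _); apply: eq_bigr => i _; rewrite liftK.
Qed.

Lemma ideal_addE J fs : ideal_add J fs = foldl adj J fs.
Proof.
apply: pred_ext => p; elim: fs J p => [|f fs IH] J p /=.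
  split=> [[q [hq /in_ideal_nil /eqP]]|hp].
    by rewrite subr_eq0 => /eqP->.
  by exists p; split=> //; apply/in_ideal_nil; rewrite subrr.
rewrite -IH; split.
  case=> q [hq /in_ideal_cons[r hr]]; exists (q + f * r); split.
    by exists r; rewrite addrK.
  by rewrite opprD addrA.
case=> q [[r hr] hq]; exists (q - f * r); split=> //.
apply/in_ideal_cons; exists r; rewrite opprB.
by rewrite addrA addrAC addrK.
Qed.

Lemma in_ideal_adj fs : in_ideal fs = foldl adj (fun q => q = 0) fs.
Proof.
rewrite -ideal_addE; apply: pred_ext => p; split=> [hp|[r [-> hp]]].
  by exists 0; rewrite subr0.
by rewrite -[p]subr0.
Qed.

Lemma zero_ideal : is_ideal (fun p : S => p = 0).
Proof.
by split=> //; split=> [a b -> ->|r a ->]; rewrite ?addr0 ?mulr0.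
Qed.

Lemma in_ideal_ideal fs : is_ideal (in_ideal fs).
Proof.
rewrite in_ideal_adj.
exact/foldl_adj_ideal/zero_ideal.
Qed.

Lemma in_ideal_mem fs f : f \in fs -> in_ideal fs f.
Proof.
move=> hf; rewrite in_ideal_adj.
elim: fs (fun q : S => q = 0) zero_ideal hf => //= g fs IH J hJ.
rewrite inE => /predU1P[->|hf].
  by apply: foldl_sub_adj; apply: adj_gen.
by apply: IH => //; apply: adj_ideal.
Qed.

Lemma in_ideal_sub fs K :
  is_ideal K -> (forall f, f \in fs -> K f) -> subideal (in_ideal fs) K.
Proof.
move=> hK hfs; rewrite in_ideal_adj.
by apply: foldl_adj_sub => // p ->; apply: ideal0.
Qed.

Lemma regularP J fs :
  (forall k, (k < size fs)%N -> forall g : S,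
     ideal_add J (take k fs) (fs`_k * g) -> ideal_add J (take k fs) g) <->
  regular J fs.
Proof.
elim: fs J => [|f fs IH] J //=; rewrite -IH; split.
  move=> h; split; first by move=> g; have:= h 0%N isT g; rewrite ideal_addE.
  by move=> k hk g; have := h k.+1 hk g; rewrite !ideal_addE.
case=> h0 h [_ g|k hk g]; first by rewrite ideal_addE; apply: h0.
by have := h k hk g; rewrite !ideal_addE.
Qed.

End IdealCalculus.

Arguments adj {F n} J x _ : rename.

(** * Squarefree monomial ideals *)

Section MonomialIdeals.
Variables (F : fieldType) (n : nat).
Local Notation S := {mpoly F[n]}.
Implicit Types (p q : S) (m : 'X_{1..n}) (D : pred {set 'I_n}).
Implicit Types (T : {set 'I_n}) (i : 'I_n).

Definition mnm_supp m : {set 'I_n} := [set i | m i != 0%N].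

Lemma mnm_suppD m1 m2 : mnm_supp (m1 + m2) = mnm_supp m1 :|: mnm_supp m2.
Proof. by apply/setP=> i; rewrite !inE mnmDE addn_eq0 negb_and. Qed.

Lemma mnm_suppU i : mnm_supp U_(i) = [set i].
Proof. by apply/setP=> j; rewrite !inE mnm1E [j == i]eq_sym; case: (i == j). Qed.

(** For upward closed [D] this is the Stanley-Reisner ideal with set of nonfaces [D]. Ideals are
    handled through their nonfaces, so that colons and sums with a variable become operations on
    predicates. *)
Definition sqfree D : S -> Prop :=
  fun p => forall m, m \in msupp p -> D (mnm_supp m).

Definition upclosed D := forall A B : {set 'I_n}, A \subset B -> D A -> D B.

Lemma sqfreeX D m : sqfree D 'X_[m] <-> D (mnm_supp m).
Proof.
split=> [h|h m']; first by apply: h; rewrite msuppX mem_head.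
by rewrite msuppX inE => /eqP->.
Qed.

Lemma sqfree_ideal D : upclosed D -> is_ideal (sqfree D).
Proof.
move=> hD; split; [|split].
- by move=> m; rewrite msupp0.
- move=> a b ha hb m /msuppD_le; rewrite mem_cat => /orP[]; [exact: ha|exact: hb].
- move=> r a ha m /msuppM_le /allpairsP[[m1 m2] /= [_ h2 ->]].
  apply: hD (ha _ h2); rewrite mnm_suppD; exact: subsetUr.
Qed.

Lemma sqfree_sub D p (K : S -> Prop) :
  is_ideal K -> (forall m, D (mnm_supp m) -> K 'X_[m]) -> sqfree D p -> K p.
Proof.
move=> hK hX hp; rewrite [p]mpolyE big_seq; apply: ideal_sum => // m hm.
by rewrite -mul_mpolyC; apply: idealM => //; apply/hX/hp.
Qed.

Lemma colon_sqfree D i :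
  colon (sqfree D) 'X_i = sqfree (fun A => D (i |: A)).
Proof.
apply: pred_ext => p; rewrite /colon mulrC; split=> h m hm.
  have := h (U_(i) + m)%MM; rewrite mnm_suppD mnm_suppU; apply.
  by rewrite (perm_mem (msuppMX _ _)) map_f.
move: hm; rewrite (perm_mem (msuppMX _ _)) => /mapP[m' hm' ->].
by rewrite mnm_suppD mnm_suppU; apply: h.
Qed.

Definition mpart (P : pred 'X_{1..n}) p : S :=
  \sum_(m <- msupp p | P m) p@_m *: 'X_[m].

Lemma mcoeff_mpart P p m : (mpart P p)@_m = if P m then p@_m else 0.
Proof.
rewrite /mpart raddf_sum /=.
have [hm|hm] := boolP (m \in msupp p); last first.
  rewrite big1_seq; first by rewrite memN_msupp_eq0 ?if_same.
  move=> m' /andP[_ hm']; rewrite mcoeffZ mcoeffX.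
  by case: eqP hm' => [->|_]; rewrite ?(negbTE hm) ?mulr0.
rewrite big_mkcond (bigD1_seq m) //= big1 ?addr0.
  by case: ifP; rewrite // mcoeffZ mcoeffX eqxx mulr1.
move=> m' hm'; case: ifP => // _.
by rewrite mcoeffZ mcoeffX (negbTE hm') mulr0.
Qed.

Lemma mpartK P p : p - mpart P p = mpart (predC P) p.
Proof.
apply/mpolyP=> m; rewrite mcoeffB !mcoeff_mpart /=.
by case: (P m); rewrite ?subrr ?subr0.
Qed.

Lemma msupp_mpart P p m : m \in msupp (mpart P p) = P m && (m \in msupp p).
Proof. by rewrite !mcoeff_msupp mcoeff_mpart; case: (P m); rewrite ?eqxx. Qed.

Lemma mpart_var i p : exists q, mpart (fun m => m i != 0%N) p = 'X_i * q.
Proof.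
exists (\sum_(m <- msupp p | m i != 0%N) p@_m *: 'X_[(m - U_(i))%MM]).
rewrite mulr_sumr; apply: eq_bigr => m hm.
rewrite -scalerAr -mpolyXD addmC submK //; apply/mnm_lepP => j.
by rewrite mnm1E; case: eqP => // <-; rewrite lt0n.
Qed.

Lemma adj_sqfree D i :
  upclosed D -> adj (sqfree D) 'X_i = sqfree (fun A => (i \in A) || D A).
Proof.
move=> hD; apply: pred_ext => p; split.
  case=> q hq m; rewrite -[p](subrK ('X_i * q)) => /msuppD_le.
  rewrite mem_cat => /orP[/hq ->|]; first by rewrite orbT.
  rewrite mulrC (perm_mem (msuppMX _ _)) => /mapP[m' _ ->].
  by rewrite inE mnmDE mnm1E eqxx.
move=> hp; have [q hq] := mpart_var i p; exists q; rewrite -hq mpartK => m.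
by rewrite msupp_mpart /= negbK => /andP[/eqP hm /hp]; rewrite inE hm.
Qed.

Definition vprime T : S -> Prop := sqfree (fun A => A :&: T != set0).

Lemma upclosed_meets T : upclosed (fun A => A :&: T != set0).
Proof.
move=> A B hAB /set0Pn[x]; rewrite inE => /andP[hA hT].
by apply/set0Pn; exists x; rewrite inE hT (subsetP hAB).
Qed.

Lemma vprime_ideal T : is_ideal (vprime T).
Proof. exact/sqfree_ideal/upclosed_meets. Qed.

Lemma vprime0 : vprime set0 = (fun p => p = 0).
Proof.
apply: pred_ext => p; split=> [h|->]; last by move=> m; rewrite msupp0.
apply/msuppnil0; case E: (msupp p) => [|m s] //.
by have := h m; rewrite E mem_head setI0 eqxx => /(_ isT).
Qed.

Lemma adj_vprime T i : adj (vprime T) 'X_i = vprime (i |: T).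
Proof.
rewrite /vprime adj_sqfree; last exact: upclosed_meets.
congr sqfree; apply: functional_extensionality => A.
apply/orP/set0Pn => [[hi|/set0Pn[x]]|[x]].
- by exists i; rewrite !inE hi eqxx.
- by rewrite inE => /andP[hA hT]; exists x; rewrite !inE hA hT orbT.
- rewrite !inE => /andP[hA /orP[/eqP <-|hT]]; first by left.
  by right; apply/set0Pn; exists x; rewrite inE hA.
Qed.

Lemma vprimeX T i : vprime T 'X_i <-> i \in T.
Proof.
rewrite /vprime sqfreeX mnm_suppU; split.
  by case/set0Pn=> x; rewrite !inE => /andP[/eqP->].
by move=> hi; apply/set0Pn; exists i; rewrite !inE eqxx.
Qed.

Lemma vprime_sub T (K : S -> Prop) :
  is_ideal K -> (forall i, i \in T -> K 'X_i) -> subideal (vprime T) K.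
Proof.
move=> hK hT p; apply: sqfree_sub => // m /set0Pn[i].
rewrite !inE => /andP[hm hi].
rewrite -(@submK _ U_(i) m) ?mpolyXD; first by apply: idealM; auto.
apply/mnm_lepP => j; rewrite mnm1E; case: eqP => // <-; by rewrite lt0n.
Qed.

Lemma vprime_subset T T' : T \subset T' -> subideal (vprime T) (vprime T').
Proof.
move=> h; apply: vprime_sub; first exact: vprime_ideal.
by move=> i hi; apply/vprimeX/(subsetP h).
Qed.

(* Modulo vprime T every polynomial agrees with its part avoiding the
   variables of T, and these parts form an integral domain. *)
Lemma vprime_prime T : is_prime (vprime T).
Proof.
split; first exact: vprime_ideal; split.
  move=> /(_ 0%MM); rewrite msupp1 mem_head => /(_ isT)/set0Pn[x].
  by rewrite !inE mnm0E.
move=> a b hab; apply: NNPP => /not_or_and[ha hb].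
pose P m := mnm_supp m :&: T == set0.
have hI := vprime_ideal T.
have hP p : vprime T (p - mpart P p).
  by move=> m; rewrite mpartK msupp_mpart => /andP[].
have nz p : ~ vprime T p -> mpart P p != 0.
  move=> hp; apply/eqP=> h0; apply: hp; have := hP p.
  by rewrite h0 subr0.
have: vprime T (mpart P a * mpart P b).
  have -> : mpart P a * mpart P b =
     a * b - (a - mpart P a) * b - mpart P a * (b - mpart P b) by ring.
  apply: (idealB hI); last exact: (idealM _ hI).
  by apply: (idealB hI) => //; apply: (idealMr _ hI).
have : mpart P a * mpart P b != 0 by rewrite mulf_neq0 ?nz.
case E: (msupp (mpart P a * mpart P b)) => [|m s].
  by rewrite (msuppnil0 E) eqxx.
move=> _ h; have hm : m \in msupp (mpart P a * mpart P b).
  by rewrite E mem_head.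
have /negP := h m hm; apply.
case/msuppM_le/allpairsP: hm => [[m1 m2] /= []].
rewrite !msupp_mpart => /andP[/eqP h1 _] /andP[/eqP h2 _] ->.
by rewrite mnm_suppD setIUl h1 h2 setU0.
Qed.

Lemma prime_nzd (P : S -> Prop) x : is_prime P -> ~ P x -> nzd P x.
Proof. by case=> _ [_ hP] hx g /hP []. Qed.

Definition edge_dep (e : rel 'I_n) : pred {set 'I_n} :=
  fun A => [exists a in A, exists b in A, e a b].

Lemma edge_depP (e : rel 'I_n) (A : {set 'I_n}) :
  reflect (exists a b, [/\ a \in A, b \in A & e a b]) (edge_dep e A).
Proof.
apply: (iffP existsP) => [[a /andP[ha /existsP[b /andP[hb h]]]]|[a [b [ha hb h]]]].
  by exists a, b.
by exists a; rewrite ha; apply/existsP; exists b; rewrite hb.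
Qed.

Lemma edge_dep_up (e : rel 'I_n) : upclosed (edge_dep e).
Proof.
move=> A B /subsetP hAB /edge_depP[a [b [ha hb h]]].
by apply/edge_depP; exists a, b; split; auto.
Qed.

Lemma edge_idealE (e : rel 'I_n) :
  simple_graph e -> @edge_ideal F n e = sqfree (edge_dep e).
Proof.
move=> [_ hirr]; apply: pred_ext => p; split; last first.
  apply: sqfree_sub; first exact: in_ideal_ideal.
  move=> m /edge_depP[a [b []]]; rewrite !inE => ha hb hab.
  rewrite -(@submK _ (U_(a) + U_(b))%MM m) ?mpolyXD.
    apply: idealM; first exact: in_ideal_ideal.
    apply: in_ideal_mem; apply/mapP; exists (a, b) => //.
    by rewrite mem_enum.
  apply/mnm_lepP => j; rewrite mnmDE !mnm1E.
  (* Without loops the generator is squarefree; a loop would give x_a^2, which need not divide a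
     monomial whose support contains a. *)
  have hne : a != b by apply: contraTneq hab => ->; rewrite hirr.
  move: ha hb hne; case: (eqVneq a j) => [->|_]; case: (eqVneq b j) => [->|_];
    rewrite ?eqxx //= ?addn0 lt0n //.
apply: in_ideal_sub; first exact/sqfree_ideal/edge_dep_up.
move=> f /mapP[[a b]]; rewrite mem_enum inE /= => hab ->.
rewrite -mpolyXD; apply/sqfreeX/edge_depP; exists a, b.
by rewrite mnm_suppD !mnm_suppU !inE !eqxx orbT.
Qed.

Lemma edge_ideal_ideal (e : rel 'I_n) : is_ideal (@edge_ideal F n e).
Proof. exact: in_ideal_ideal. Qed.

End MonomialIdeals.

(** * Free resolutions *)

Lemma row_choice (R : nzRingType) (a b : nat) (P : 'I_a -> 'rV[R]_b -> Prop) :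
  (forall i, exists u, P i u) -> exists M : 'M[R]_(a, b), forall i, P i (row i M).
Proof.
move=> h; suff [f hf] : exists f : 'I_a -> 'rV[R]_b, forall i, P i (f i).
  by exists (\matrix_i f i) => i; rewrite rowK.
by apply: (fin_all_exists (P := P)).
Qed.

Section Resolutions.
Variables (F : fieldType) (n : nat).
Local Notation S := {mpoly F[n]}.
Implicit Types (J : S -> Prop) (x p : S).

(* S^b / K has a free resolution of length at most r whose first term is the
   given S^b. *)
Fixpoint pd_le (r b : nat) (K : 'rV[S]_b -> Prop) : Prop :=
  match r with
  | 0 => forall u, K u <-> u = 0
  | r'.+1 => exists (b' : nat) (d : 'M[S]_(b', b)),
      (forall u, K u <-> exists w, u = w *m d) /\ pd_le r' (fun w => w *m d = 0)
  end.

Lemma pd_leS r b (K : 'rV[S]_b -> Prop) : pd_le r K -> pd_le r.+1 K.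
Proof.
elim: r b K => [|r IH] b K.
  move=> h; exists 0%N, 0; split=> [u|w] /=.
    rewrite h; split=> [->|[w ->]]; first by exists 0; rewrite mulmx0.
    by rewrite mulmx0.
  by split=> _; [apply/rowP=> [[]]|rewrite mulmx0].
by case=> b' [d [hK hd]]; exists b', d; split=> //; apply: IH.
Qed.

Definition submodule b (K : 'rV[S]_b -> Prop) :=
  [/\ K 0, forall u v, K u -> K v -> K (u + v) & forall a u, K u -> K (a *: u)].

Lemma submodule_mul b c (K : 'rV[S]_b -> Prop) (M : 'M[S]_(c, b)) w :
  submodule K -> (forall i, K (row i M)) -> K (w *m M).
Proof.
case=> h0 hD hZ hM; rewrite mulmx_sum_row.
by apply: (big_ind K) => // i _; apply: hZ.
Qed.

(** K is an extension of its projection to the second block by its intersection with the first. The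
    rows of [H] lift the generators [d2] of the projection into K, and the syzygies of the resulting
    block matrix are again such an extension, so the induction continues. *)
Lemma pd_le_horseshoe r a b (K : 'rV[S]_(a + b) -> Prop) :
  submodule K ->
  pd_le r (fun u => K (row_mx u 0)) ->
  pd_le r (fun v => exists u, K (row_mx u v)) -> pd_le r K.
Proof.
elim: r a b K => [|r IH] a b K hK.
  move=> h1 h2 u; split=> [|->]; last by case: hK.
  rewrite -[u]hsubmxK => hu.
  have hv : rsubmx u = 0 by apply/h2; exists (lsubmx u).
  by rewrite hv in hu *; have /h1 -> := hu; rewrite row_mx0.
have [h0 hD hZ] := hK.
case=> a' [d1 [h1 r1]] [b' [d2 [h2 r2]]].
have [i|H hH] := @row_choice _ b' a (fun i u => K (row_mx u (row i d2))).
  by apply/h2; exists (delta_mx 0 i); rewrite -rowE.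
have hH' w : K (row_mx (w *m H) (w *m d2)).
  rewrite -mul_mx_row; apply: submodule_mul => // i.
  by rewrite row_row_mx.
exists (a' + b')%N, (block_mx d1 0 H d2); split.
  move=> u; split.
    rewrite -[u]hsubmxK => hu.
    have /h2[w2 hw2] : exists u', K (row_mx u' (rsubmx u)) by exists (lsubmx u).
    have /h1[w1 hw1] : K (row_mx (lsubmx u - w2 *m H) 0).
      have := hD _ _ hu (hZ (-1) _ (hH' w2)).
      by rewrite scaleN1r opp_row_mx add_row_mx hw2 subrr.
    exists (row_mx w1 w2); rewrite mul_row_block mulmx0 add0r -hw1 -hw2.
    by rewrite subrK.
  case=> w ->; rewrite -[w]hsubmxK mul_row_block mulmx0 add0r.
  rewrite -[rsubmx w *m d2]add0r -add_row_mx; apply: hD => //.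
  by apply/h1; exists (lsubmx w).
apply: IH.
- split; first by rewrite mul0mx.
    by move=> u v hu hv; rewrite mulmxDl hu hv addr0.
  by move=> c u hu; rewrite -scalemxAl hu scaler0.
- congr (pd_le r _): r1; apply: pred_ext => w.
  rewrite mul_row_block !mul0mx !addr0 mulmx0.
  by split=> [->|]; [rewrite row_mx0|rewrite -row_mx0 => /eq_row_mx[]].
- congr (pd_le r _): r2; apply: pred_ext => w.
  split=> [hw|[u]]; last first.
    by rewrite mul_row_block mulmx0 add0r -row_mx0 => /eq_row_mx[].
  have /h1[u hu] : K (row_mx (w *m H) 0) by rewrite -hw; apply: hH'.
  exists (- u); rewrite mul_row_block mulmx0 add0r hw mulNmx hu addNr.
  by rewrite row_mx0.
Qed.

Definition pdJ_le r J := exists (b : nat) (c : 'cV[S]_b),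
  (forall p, exists u : 'rV_b, J (p - (u *m c) 0 0)) /\
  pd_le r (fun u => J ((u *m c) 0 0)).

Lemma pdJ_leW r r' J : (r <= r')%N -> pdJ_le r J -> pdJ_le r' J.
Proof.
move=> /subnK <- [b [c [hs h]]]; exists b, c; split=> //.
by elim: (r' - r)%N => //= k; apply: pd_leS.
Qed.

Lemma mx_submodule J b (c : 'cV[S]_b) :
  is_ideal J -> submodule (fun u => J ((u *m c) 0 0)).
Proof.
move=> hJ; split; first by rewrite mul0mx mxE; apply: ideal0.
  by move=> u v hu hv; rewrite mulmxDl mxE; apply: idealD.
by move=> a u hu; rewrite -scalemxAl mxE; apply: idealM.
Qed.

(** Multiplication by x embeds S/(J:x) into S/J, so generators of the middle term are x times those
    of the left end, followed by lifts of those of the right end. Their relations form the extension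
    treated by the horseshoe lemma. *)
Lemma pdJ_le_colon r J x :
  is_ideal J -> pdJ_le r (colon J x) -> pdJ_le r (adj J x) -> pdJ_le r J.
Proof.
move=> hJ [a [c1 [s1 h1]]] [b [c2 [s2 h2]]].
exists (a + b)%N, (col_mx (x *: c1) c2).
have E u v : (row_mx u v *m col_mx (x *: c1) c2) 0 0 =
    x * (u *m c1) 0 0 + (v *m c2) 0 0.
  by rewrite mul_row_col mxE -scalemxAr mxE.
split=> [p|].
  have [v [q hq]] := s2 p; have [u hu] := s1 q.
  exists (row_mx u v); rewrite E.
  have -> : p - (x * (u *m c1) 0 0 + (v *m c2) 0 0) =
    (p - (v *m c2) 0 0 - x * q) + x * (q - (u *m c1) 0 0) by ring.
  exact: idealD.
apply: pd_le_horseshoe; first exact: mx_submodule.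
- congr (pd_le r _): h1; apply: pred_ext => u; rewrite E mul0mx.
  by rewrite [X in _ + X]mxE addr0.
- congr (pd_le r _): h2; apply: pred_ext => v; split.
    case=> q hq; have [u hu] := s1 (- q); exists u; rewrite E.
    have -> : x * (u *m c1) 0 0 + (v *m c2) 0 0 =
      ((v *m c2) 0 0 - x * q) - x * (- q - (u *m c1) 0 0) by ring.
    exact: idealB.
  case=> u; rewrite E => hu; exists (- (u *m c1) 0 0).
  by rewrite mulrN opprK addrC.
Qed.

(* The kernel of S^b' + S^b -> S^b, (w, u) |-> w d + x u, is an extension of
   the first syzygies of J by ker d. *)
Lemma pdJ_le_cone r J x :
  is_ideal J -> nzd J x -> pdJ_le r J -> pdJ_le r.+1 (adj J x).
Proof.
move=> hJ hx [b [c [hs h]]]; exists b, c; split.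
  by move=> p; have [u hu] := hs p; exists u; apply: sub_adj.
have E (u v : 'rV_b) :
    ((x *: u + v) *m c) 0 0 = x * (u *m c) 0 0 + (v *m c) 0 0.
  by rewrite mulmxDl -scalemxAl mxE; congr (_ + _); rewrite mxE.
have hK (u : 'rV_b) : adj J x ((u *m c) 0 0) <->
    exists v w : 'rV_b, J ((w *m c) 0 0) /\ u = x *: v + w.
  split=> [[q hq]|[v [w [hw ->]]]].
    have [v hv] := hs q; exists v, (u - x *: v).
    have -> : u - x *: v = x *: (- v) + u by rewrite scalerN addrC.
    split; last by rewrite scalerN addrA subrr add0r.
    have N : ((- v) *m c) 0 0 = - (v *m c) 0 0 by rewrite mulNmx mxE.
    rewrite E N.
    have -> : x * - (v *m c) 0 0 + (u *m c) 0 0 =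
      ((u *m c) 0 0 - x * q) + x * (q - (v *m c) 0 0) by ring.
    by apply: idealD => //; apply: idealM.
  by exists ((v *m c) 0 0); rewrite E addrC addKr.
have hx' u : J (((x *: u) *m c) 0 0) -> J ((u *m c) 0 0).
  by rewrite -scalemxAl mxE => /hx.
(* In length 0 there are no first syzygies, so x times the identity is injective and already is the
   whole resolution. *)
case: r h => [|r] h.
  exists b, (x%:M); split.
    move=> u; rewrite hK; split.
      by case=> v [w [/h -> ->]]; exists v; rewrite mul_mx_scalar addr0.
    case=> v ->; exists v, 0; split; last by rewrite mul_mx_scalar addr0.
    exact/h.
  move=> u; rewrite mul_mx_scalar; split=> [h0|->]; last by rewrite scaler0.
  by apply/h/hx'/h.
have h2 := h; have {h} [b' [d [hd hr]]] := h.
exists (b' + b)%N, (col_mx d x%:M); split.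
  move=> u; rewrite hK; split.
    case=> v [w [/hd[w' ->] ->]]; exists (row_mx w' v).
    by rewrite mul_row_col mul_mx_scalar addrC.
  case=> w ->; exists (rsubmx w), (lsubmx w *m d).
  split; first by apply/hd; exists (lsubmx w).
  by rewrite -{1}[w]hsubmxK mul_row_col mul_mx_scalar addrC.
apply: pd_le_horseshoe.
- split; first by rewrite mul0mx.
    by move=> u v hu hv; rewrite mulmxDl hu hv addr0.
  by move=> a u hu; rewrite -scalemxAl hu scaler0.
- apply: pd_leS; congr (pd_le r _): hr; apply: pred_ext => w.
  by rewrite mul_row_col mul0mx addr0.
- congr (pd_le r.+1 _): h2; apply: pred_ext => v.
  split=> [/hd[w ->]|[u]].
    exists (- (x *: w)); rewrite mul_row_col mul_mx_scalar mulNmx -scalemxAl.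
    by rewrite addNr.
  rewrite mul_row_col mul_mx_scalar => /eqP; rewrite addr_eq0 => /eqP hu.
  apply: hx'; apply/hd; exists (- u).
  by rewrite mulNmx hu opprK.
Qed.

Lemma pdJ_le_zero : pdJ_le 0 (fun p : S => p = 0).
Proof.
exists 1%N, 1%:M; split=> [p|u /=].
  by exists (const_mx p); rewrite mulmx1 mxE subrr.
rewrite mulmx1; split=> [h|->]; last by rewrite mxE.
by apply/matrixP=> i j; rewrite !ord1 mxE.
Qed.

(** Unrolls the nested existentials into families indexed by all naturals, padded with rank 0. The
    term of index 0 covers K and not S^b, hence the vanishing from r on. *)
Lemma pd_le_complex r b (K : 'rV[S]_b -> Prop) : pd_le r K ->
  exists (rk : nat -> nat) (d0 : 'M[S]_(rk 0%N, b))
         (d : forall i, 'M[S]_(rk i.+1, rk i)),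
  [/\ forall i, (r <= i)%N -> rk i = 0%N,
      forall u : 'rV_b, K u <-> exists w, u = w *m d0,
      forall w : 'rV_(rk 0%N), w *m d0 = 0 <-> exists z, w = z *m d 0%N &
      forall i (u : 'rV_(rk i.+1)),
        u *m d i = 0 <-> exists w : 'rV_(rk i.+2), u = w *m d i.+1].
Proof.
elim: r b K => [|r IH] b K.
  move=> h; exists (fun=> 0%N), 0, (fun=> 0); split=> //.
  - move=> u; rewrite h; split=> [->|[w ->]]; last by rewrite mulmx0.
    by exists 0; rewrite mulmx0.
  - move=> w; split=> _; last by rewrite mulmx0.
    by exists 0; apply/rowP=> [[]].
  - move=> i w; split=> _; last by rewrite mulmx0.
    by exists 0; apply/rowP=> [[]].
case=> b' [d' [hK /IH [rk [d0 [d [h1 h2 h3 h4]]]]]].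
exists (fun i => if i is j.+1 then rk j else b'), d'.
exists (fun i => match i return 'M[S]_(rk i, if i is j.+1 then rk j else b')
  with 0 => d0 | j.+1 => d j end).
split=> //; first by case.
by case.
Qed.

Lemma pdJ_le_has_free_res r J : pdJ_le r J -> has_free_res J r.
Proof.
case=> b [c [hs /pd_le_complex [rk [d0 [d [h1 h2 h3 h4]]]]]].
suff R : free_resolution J r by exists R.
apply: (@FreeRes _ _ J r (fun i => if i is j.+1 then rk j else b)
  (fun i => match i return 'M[S]_(rk i, if i is j.+1 then rk j else b)
    with 0 => d0 | j.+1 => d j end) c) => //; last by case.
by case=> // i; apply: h1.
Qed.

End Resolutions.

(** * Lower bound for the length of a resolution *)

Section ResolutionLengthBound.
Variables (F : fieldType) (n : nat).
Local Notation S := {mpoly F[n]}.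
Implicit Types (J Q : S -> Prop) (x p : S).

Definition vmod Q b (u : 'rV[S]_b) := forall j, Q (u 0 j).

Lemma vmodD Q b (u v : 'rV_b) :
  is_ideal Q -> vmod Q u -> vmod Q v -> vmod Q (u + v).
Proof. by move=> hQ hu hv j; rewrite mxE; apply: idealD. Qed.

Lemma vmodZ Q b a (u : 'rV_b) : is_ideal Q -> vmod Q u -> vmod Q (a *: u).
Proof. by move=> hQ hu j; rewrite mxE; apply: idealM. Qed.

Lemma vmodN Q b (u : 'rV_b) : is_ideal Q -> vmod Q u -> vmod Q (- u).
Proof. by move=> hQ hu; rewrite -scaleN1r; apply: vmodZ. Qed.

Lemma vmodM Q b c (u : 'rV_b) (M : 'M_(b, c)) :
  is_ideal Q -> vmod Q u -> vmod Q (u *m M).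
Proof.
move=> hQ hu j; rewrite mxE; apply: ideal_sum => // k _.
exact: idealMr.
Qed.

Lemma vmod_nzd Q x b (u : 'rV_b) : nzd Q x -> vmod Q (x *: u) -> vmod Q u.
Proof. by move=> hx hu j; apply: hx; have := hu j; rewrite mxE. Qed.

Lemma vmod_adj Q x b (u : 'rV_b) :
  vmod (adj Q x) u -> exists v, vmod Q (u - x *: v).
Proof.
move=> hu.
have [f hf] := fin_all_exists (P := fun j q => Q (u 0 j - x * q)) hu.
by exists (\row_j f j) => j; rewrite !mxE.
Qed.

Lemma adj_vmod Q x b (u v : 'rV_b) :
  vmod Q (u - x *: v) -> vmod (adj Q x) u.
Proof. by move=> hu j; exists (v 0 j); have := hu j; rewrite !mxE. Qed.

Variables (J : S -> Prop) (r : nat) (R : free_resolution J r).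
Local Notation d := (fr_diff R).

Lemma fr_diffK i (w : 'rV_(fr_rank R i.+2)) : w *m d i.+1 *m d i = 0.
Proof. by apply/fr_exact; exists w. Qed.

(** Vanishing of Tor_j(S/J, S/Q) for all j > k, stated on the resolution. *)
Definition exact_mod Q k := forall i (u : 'rV_(fr_rank R i.+1)), (k <= i)%N ->
  vmod Q (u *m d i) -> exists w : 'rV_(fr_rank R i.+2), vmod Q (u - w *m d i.+1).

(** The long exact Tor sequence of multiplication by x on S/Q, which costs one degree. If u d = x v
    modulo Q, then v is a cycle, hence v = w d, and u - x w is a cycle modulo Q. *)
Lemma exact_mod_adj Q k x :
  is_ideal Q -> nzd Q x -> exact_mod Q k -> exact_mod (adj Q x) k.+1.
Proof.
move=> hQ hx hk [//|i] u hi /vmod_adj[v hv].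
have hi1 : (k <= i.+1)%N by apply: leq_trans hi.
have {}hi : (k <= i)%N by [].
have [w hw] : exists w, vmod Q (v - w *m d i.+1).
  apply: hk => //; apply: (vmod_nzd hx); rewrite scalemxAl.
  have := vmodN hQ (vmodM (d i) hQ hv).
  by rewrite mulmxBl fr_diffK sub0r opprK.
have [z hz] : exists z, vmod Q ((u - x *: w) - z *m d i.+2).
  apply: hk => //; rewrite mulmxBl -scalemxAl.
  have := vmodD hQ hv (vmodZ x hQ hw).
  by rewrite scalerBr addrA subrK.
exists z; apply: (@adj_vmod _ x _ _ w).
by rewrite addrAC.
Qed.

(** The row w is a nonzero class in coker(d_k) modulo Q killed by [qs]. Writing q w = w' d_k, the
    row w' is a class of the same kind for d_(k+1), modulo Q + (q) and for the remaining elements.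
    Once [qs] is exhausted, a nonzero class survives, so the rank there is nonzero and the degree is
    at most r. *)
Lemma regular_socle_bound Q k (qs : seq S) :
  is_ideal Q -> exact_mod Q k -> regular Q qs ->
  (exists w : 'rV_(fr_rank R k),
    (forall q, q \in qs -> exists v, vmod Q (q *: w - v *m d k)) /\
    ~ exists v, vmod Q (w - v *m d k)) ->
  (size qs + k <= r)%N.
Proof.
elim: qs Q k => [|q qs IH] Q k hQ hk hreg [w [hw nw]].
  rewrite add0n leqNgt; apply/negP => /(fr_len R) h0; apply: nw; exists 0.
  by rewrite mul0mx subr0 => j; exfalso; case: (j) => m; rewrite h0.
case: hreg => hq hreg; rewrite addSn -addnS.
have [w' hw'] := hw q (mem_head _ _).
apply: IH (adj_ideal q hQ) (exact_mod_adj hQ hq hk) hreg _.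
exists w'; split=> [p hp|[z /vmod_adj[y hy]]].
  have [v hv] : exists v, vmod Q (p *: w - v *m d k).
    by apply: hw; rewrite inE hp orbT.
  have [z hz] : exists z, vmod Q (p *: w' - q *: v - z *m d k.+1).
    apply: hk => //; rewrite mulmxBl -!scalemxAl.
    have := vmodD hQ (vmodN hQ (vmodZ p hQ hw')) (vmodZ q hQ hv).
    by rewrite !scalerBr opprB scalerA mulrC -scalerA addrA subrK.
  exists z; apply: (@adj_vmod _ q _ _ v).
  by rewrite addrAC.
(* If w' = z d_(k+1) + q y modulo Q, applying d_k gives q w = q y d_k; cancelling q would make w a
   boundary. *)
apply: nw; exists y; apply: (vmod_nzd hq).
have := vmodD hQ hw' (vmodM (d k) hQ hy).
by rewrite !mulmxBl fr_diffK subr0 -scalemxAl addrA subrK scalerBr.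
Qed.

Theorem regular_annihilator_bound (u : S) (qs : seq S) :
  is_ideal J -> regular (fun p => p = 0) qs ->
  (forall q, q \in qs -> J (q * u)) -> ~ J u -> (size qs <= r)%N.
Proof.
move=> hJ hreg hq hu; rewrite -[size qs]addn0.
apply: regular_socle_bound (zero_ideal _ _) _ hreg _.
  move=> i w _ hw.
  have /fr_exact[z hz] : w *m d i = 0 by apply/rowP=> j; rewrite hw mxE.
  by exists z; rewrite hz subrr => j; rewrite mxE.
have [w hw] := fr_surj R u; exists w; split=> [q /hq hqu|[v hv]].
  have /fr_exact0[v hv] : J (((q *: w) *m fr_aug R) 0 0).
    rewrite -scalemxAl mxE -[X in J X]opprK.
    apply: idealN => //; apply: (@ideal_trans _ _ _ _ (- (q * u))) => //.
      exact: idealN.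
    by rewrite opprK addrC -mulrBr; apply: idealM.
  by exists v; rewrite hv subrr => j; rewrite mxE.
apply: hu; apply: (ideal_trans hJ) hw; apply/fr_exact0; exists v.
by apply/rowP=> j; apply/eqP; rewrite -subr_eq0; apply/eqP; have := hv j; rewrite mxE mxE.
Qed.

End ResolutionLengthBound.

(** * Elementary symmetric polynomials *)

Section SymmetricSequence.
Variables (F : fieldType) (n : nat).
Local Notation S := {mpoly F[n]}.
Implicit Types (J : S -> Prop) (x p f g : S) (T : {set 'I_n}) (i : 'I_n).

(* The substitution x_i |-> x_i t; the coefficients in t are the homogeneous
   components. *)
Definition grade : S -> {poly S} :=
  mmap (polyC \o @mpolyC n F) (fun i => ('X_i)%:P * 'X).

HB.instance Definition _ := GRing.RMorphism.copy grade grade.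

Lemma gradeX i : grade 'X_i = ('X_i)%:P * 'X.
Proof. by rewrite /grade mmapX mmap1U. Qed.

Lemma gradeXm m : grade 'X_[m] = ('X_[m])%:P * 'X^(mdeg m).
Proof.
rewrite mpolyXE_id !rmorph_prod /= mdegE -prodrXr -big_split /=.
by apply: eq_bigr => i _; rewrite !rmorphXn /= gradeX exprMn.
Qed.

Lemma gradeE p :
  grade p = \sum_(m <- msupp p) (p@_m *: 'X_[m])%:P * 'X^(mdeg m).
Proof.
rewrite {1}[p]mpolyE rmorph_sum /=; apply: eq_bigr => m _.
by rewrite -mul_mpolyC rmorphM /= gradeXm {1}/grade mmapC /= polyCM mulrA.
Qed.

Lemma sum_grade p : \sum_(d < size (grade p)) (grade p)`_d = p.
Proof.
transitivity ((grade p).[1]).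
  by rewrite horner_coef; apply: eq_bigr => d _; rewrite expr1n mulr1.
rewrite gradeE {3}[p]mpolyE horner_sum; apply: eq_bigr => m _.
by rewrite hornerM hornerC hornerXn expr1n mulr1.
Qed.

Definition graded_ideal J := forall p, J p -> forall d, J (grade p)`_d.

Lemma graded_sqfree (D : pred {set 'I_n}) :
  upclosed D -> graded_ideal (sqfree D : S -> Prop).
Proof.
move=> hD p hp d; rewrite gradeE coef_sum big_seq.
have hI := sqfree_ideal F hD; apply: (ideal_sum _ hI) => m hm.
rewrite coefCM coefXn; apply: (idealMr _ hI).
by rewrite -mul_mpolyC; apply: (idealM _ hI); apply/sqfreeX/hp.
Qed.

Lemma graded_adj J f k :
  is_ideal J -> graded_ideal J -> grade f = f%:P * 'X^k -> graded_ideal (adj J f).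
Proof.
move=> hJ hh hf p [q hq] d.
exists (if (d < k)%N then 0 else (grade q)`_(d - k)).
have := hh _ hq d; rewrite rmorphB rmorphM /= hf coefB -mulrA coefCM.
by rewrite coefXnM.
Qed.

(** A graded form of Krull's intersection theorem: x_i^k h has no component below degree k, so for k
    beyond the degree of g every component of g is a component of an element of J. *)
Lemma graded_descent J i g :
  graded_ideal J -> is_ideal J -> (forall k, exists h, J (g - 'X_i ^+ k * h)) -> J g.
Proof.
move=> hh hJ hg; rewrite -[g]sum_grade; apply: ideal_sum => // d _.
have [h hk] := hg (size (grade g)); have := hh _ hk d.
rewrite rmorphB rmorphM rmorphXn /= gradeX exprMn -polyC_exp -mulrA coefB coefCM.
by rewrite coefXnM ltn_ord mulr0 subr0.
Qed.

Lemma nzdX J x k : nzd J x -> nzd J (x ^+ k).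
Proof.
move=> hx; elim: k => [g|k IH g]; first by rewrite mul1r.
by rewrite exprS -mulrA => /hx/IH.
Qed.

(** From f g in J one gets g in J + (x_i^k) for every k: if g = x_i^k h modulo J, cancel x_i^k from
    f g to obtain f h in J, hence h in J + (x_i). *)
Lemma nzd_lift J i f :
  is_ideal J -> graded_ideal J -> nzd J 'X_i -> nzd (adj J 'X_i) f -> nzd J f.
Proof.
move=> hJ hh hi hf g hg; apply: (graded_descent (i := i)) => // k.
elim: k => [|k [h IH]].
  by exists g; rewrite mul1r subrr; apply: ideal0.
have [|h' hh'] := hf h.
  apply: sub_adj; apply: (nzdX (k := k) hi).
  have -> : 'X_i ^+ k * (f * h) = f * g - f * (g - 'X_i ^+ k * h) by ring.
  by apply: idealB => //; apply: idealM.
exists h'.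
have -> : g - 'X_i ^+ k.+1 * h' =
  (g - 'X_i ^+ k * h) + 'X_i ^+ k * (h - 'X_i * h') by rewrite exprS; ring.
by apply: idealD => //; apply: idealM.
Qed.

(** Moves x_i from the front of a regular sequence to its end. Homogeneity of [fs] keeps the
    successive ideals graded, as [nzd_lift] demands. *)
Lemma regular_lift J i (fs : seq S) :
  is_ideal J -> graded_ideal J ->
  (forall f, f \in fs -> exists k, grade f = f%:P * 'X^k) ->
  nzd J 'X_i -> regular (adj J 'X_i) fs ->
  regular J fs /\ nzd (foldl adj J fs) 'X_i.
Proof.
elim: fs J => [|f fs IH] J hJ hh hfs hi //= [h1 h2].
have hf : nzd J f by apply: nzd_lift h1.
have [k hk] := hfs f (mem_head _ _).
have [|||||] := IH (adj J f) => //.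
- exact: adj_ideal.
- exact: graded_adj hk.
- by move=> g hg; apply: hfs; rewrite inE hg orbT.
- exact: nzd_adj.
- by rewrite adjC.
Qed.

Lemma grade_mesym k : grade (mesym n F k) = (mesym n F k)%:P * 'X^k.
Proof.
rewrite /mesym !rmorph_sum mulr_suml; apply: eq_bigr => h /eqP <-.
rewrite !rmorph_prod -prodr_const -big_split /=.
by apply: eq_bigr => i _; rewrite gradeX.
Qed.

(** Only one k-subset avoids T, namely its complement; every other term of the symmetric polynomial
    contains a variable of T. *)
Lemma mesym_vprime T k : (k + #|T|)%N = n ->
  vprime T (mesym n F k - \prod_(i in ~: T) 'X_i).
Proof.
move=> hk; rewrite /mesym (bigD1 (~: T)); last first.
  by apply/eqP; have := cardsC T; rewrite card_ord; lia.
have hI := vprime_ideal F T; rewrite /= addrC addrK; apply: (ideal_sum _ hI).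
move=> h /andP[/eqP hc hT].
have [j hjh hjT] : exists2 j, j \in h & j \in T.
  apply/exists_inP; apply: contraNT hT; rewrite negb_exists_in => /forall_inP hh.
  rewrite eqEcard hc; apply/andP; split.
    by apply/subsetP => j /hh; rewrite inE.
  by have := cardsC T; rewrite card_ord; lia.
by rewrite (bigD1 j) //=; apply: (idealMr _ hI); apply/vprimeX.
Qed.

Definition esyms k : seq S := [seq mesym n F j.+1 | j <- iota 0 k].

Lemma esymsS k : esyms k.+1 = rcons (esyms k) (mesym n F k.+1).
Proof. by rewrite /esyms -[in LHS](addn1 k) iotaD map_cat cats1 add0n. Qed.

Lemma nzd_prod J (A : {set 'I_n}) (h : 'I_n -> S) :
  (forall i, i \in A -> nzd J (h i)) -> nzd J (\prod_(i in A) h i).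
Proof.
move=> hA; apply: (big_ind (nzd J)) => //.
  by move=> g; rewrite mul1r.
by move=> a b ha hb g; rewrite -mulrA => /ha/hb.
Qed.

(** Induction on the number of variables outside T. If k < n - |T|, enlarge T by one variable and
    lift back. If k = n - |T|, the first k - 1 polynomials are regular in this way, each remaining
    variable is a nonzerodivisor after them, and the last polynomial is congruent to the product of
    these variables. *)
Lemma esyms_regular T k : (k + #|T| <= n)%N -> regular (vprime T) (esyms k).
Proof.
have [w hw] := ubnP (n - #|T|); elim: w T k hw => // w IH T k hw hk.
have step k' i : (k' + #|T| < n)%N -> i \notin T ->
    regular (vprime T) (esyms k') /\ nzd (foldl adj (vprime T) (esyms k')) 'X_i.
  move=> hk' hi; apply: regular_lift.
  - exact: vprime_ideal.
  - exact/graded_sqfree/upclosed_meets.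
  - by move=> f /mapP[j _ ->]; exists j.+1; apply: grade_mesym.
  - by apply: prime_nzd; [apply: vprime_prime|rewrite vprimeX; apply/negP].
  - by rewrite adj_vprime; apply: IH; rewrite cardsU1 hi; lia.
have ex : (#|T| < n)%N -> exists i, i \notin T.
  move=> hT; apply/existsP; rewrite -negb_forall; apply: contraTN hT => /forallP h.
  rewrite -leqNgt -[X in (X <= _)%N]card_ord; apply: subset_leq_card.
  by apply/subsetP.
case: (ltnP (k + #|T|) n) => [hlt|hge].
  have [|i hi] := ex; first by lia.
  by case: (step k i).
case: k hk hge => [//|k] hk hge; rewrite esymsS; apply/regular_rcons; split.
  have [|i hi] := ex; first by lia.
  by case: (step k i) => //; lia.
move=> g hg; set J := foldl _ _ _ in hg *.
have hJ : is_ideal J by apply/foldl_adj_ideal/vprime_ideal.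
have hP : nzd J (\prod_(i in ~: T) 'X_i).
  apply: nzd_prod => i; rewrite inE => hi.
  by case: (step k i) => //; lia.
apply: hP.
have hE : J (mesym n F k.+1 - \prod_(i in ~: T) 'X_i).
  by apply/foldl_sub_adj/mesym_vprime; lia.
have -> : \prod_(i in ~: T) 'X_i * g = mesym n F k.+1 * g -
   (mesym n F k.+1 - \prod_(i in ~: T) 'X_i) * g by ring.
by apply: idealB => //; apply: idealMr.
Qed.

End SymmetricSequence.

(** * Koszul homology and depth *)

Section Koszul.
Variables (F : fieldType) (n : nat).
Local Notation S := {mpoly F[n]}.
Implicit Types (J K : S -> Prop) (qs fs : seq S) (s t : bitseq) (phi psi : bitseq -> S).

(* The Koszul complex on qs: a chain is its family of coefficients, indexed by
   the characteristic bit sequences of the subsets of the index set; the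
   homological degree is the number of ones. *)
Fixpoint kdiff qs phi s : S :=
  match qs, s with
  | q :: qs', b :: s' =>
      if b then - kdiff qs' (fun t => phi (true :: t)) s'
      else kdiff qs' (fun t => phi (false :: t)) s' + q * phi (true :: s')
  | _, _ => 0
  end.

(** Exterior multiplication by the j-th basis vector: a homotopy between multiplication by the j-th
    element of [qs] and zero. *)
Fixpoint khomotopy (j : nat) phi s : S :=
  match j, s with
  | _, [::] => 0
  | 0, b :: s' => if b then phi (false :: s') else 0
  | j'.+1, b :: s' =>
      if b then - khomotopy j' (fun t => phi (true :: t)) s'
      else khomotopy j' (fun t => phi (false :: t)) s'
  end.

Lemma kdiffD qs phi psi (a : S) s :
  kdiff qs (fun t => phi t + a * psi t) s = kdiff qs phi s + a * kdiff qs psi s.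
Proof.
elim: qs phi psi s => [|q qs IH] phi psi [|[] s] //=; rewrite ?IH; ring.
Qed.

Lemma kdiff0 qs s : kdiff qs (fun=> 0) s = 0.
Proof.
elim: qs s => [|q qs IH] [|[] s] //=; rewrite IH ?oppr0 //.
by rewrite mulr0 addr0.
Qed.

Lemma kdiffM qs phi (a : S) s : kdiff qs (fun t => a * phi t) s = a * kdiff qs phi s.
Proof.
have := kdiffD qs (fun=> 0) phi a s; rewrite kdiff0 add0r => <-.
by congr kdiff; apply: functional_extensionality => t; rewrite add0r.
Qed.

Lemma kdiffN qs phi s : kdiff qs (fun t => - phi t) s = - kdiff qs phi s.
Proof.
rewrite -mulN1r -kdiffM; congr kdiff.
by apply: functional_extensionality => t; rewrite mulN1r.
Qed.

Lemma khomotopyD j phi psi (a : S) s :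
  khomotopy j (fun t => phi t + a * psi t) s =
  khomotopy j phi s + a * khomotopy j psi s.
Proof.
elim: j phi psi s => [|j IH] phi psi [|[] s] //=; rewrite ?IH; ring.
Qed.

Lemma khomotopyN j phi s :
  khomotopy j (fun t => - phi t) s = - khomotopy j phi s.
Proof.
elim: j phi s => [|j IH] phi [|[] s] //=; rewrite ?oppr0 // ?IH //.
Qed.

Lemma kdiffK qs phi s : kdiff qs (kdiff qs phi) s = 0.
Proof.
elim: qs phi s => [|q qs IH] phi [|[] s] //=.
  by rewrite kdiffN IH !oppr0.
by rewrite kdiffD IH mulrN add0r subrr.
Qed.

Lemma khomotopyP qs j phi s : (j < size qs)%N -> size s = size qs ->
  kdiff qs (khomotopy j phi) s + khomotopy j (kdiff qs phi) s = qs`_j * phi s.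
Proof.
elim: qs j phi s => [|q qs IH] [|j] phi [|b s] //= hj [hs].
  case: b => /=; last by rewrite kdiff0 add0r addr0.
  by rewrite addKr.
have {}IH := IH j _ s hj hs.
case: b => /=; first by rewrite kdiffN khomotopyN !opprK IH.
by rewrite khomotopyD -(IH (fun t => phi (false :: t))); ring.
Qed.

Lemma kdiff_ideal J qs phi s : is_ideal J ->
  (forall t, size t = size s -> count id t = (count id s).+1 -> J (phi t)) ->
  J (kdiff qs phi s).
Proof.
move=> hJ; elim: qs phi s => [|q qs IH] phi [|b s] h /=;
  try exact: ideal0.
case: b h => h /=.
  apply: idealN => //; apply: IH => t ht hc; apply: h; rewrite /= ?ht //.
  by rewrite hc.
apply: idealD => //; last by apply: idealM => //; apply: h.
by apply: IH => t ht hc; apply: h; rewrite /= ?ht.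
Qed.

Lemma khomotopy_ideal J j phi s : is_ideal J ->
  (forall t, size t = size s -> (count id t).+1 = count id s -> J (phi t)) ->
  J (khomotopy j phi s).
Proof.
move=> hJ; elim: j phi s => [|j IH] phi [|b s] h /=; try exact: ideal0.
  by case: b h => h; [apply: h|apply: ideal0].
case: b h => h /=; first apply: idealN => //; apply: IH => t ht hc; apply: h;
  by rewrite /= ?ht // -hc.
Qed.

Lemma kdiff_mem J qs phi s : is_ideal J ->
  (forall j, (j < size qs)%N -> (j < size s)%N -> ~~ nth false s j ->
     J (qs`_j * phi (set_nth false s j true))) ->
  J (kdiff qs phi s).
Proof.
move=> hJ; elim: qs phi s => [|q qs IH] phi [|b s] h /=; try exact: ideal0.
have h' : J (kdiff qs (fun t => phi (b :: t)) s).
  by apply: IH => j h1 h2 h3; apply: (h j.+1).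
case: b h h' => h h'; first exact: idealN.
by apply: idealD => //; apply: (h 0%N).
Qed.

Definition kcycle J qs i phi :=
  forall s, size s = size qs -> (count id s).+1 = i -> J (kdiff qs phi s).

Definition kbound J qs i phi := exists psi,
  forall s, size s = size qs -> count id s = i -> J (phi s - kdiff qs psi s).

Lemma kcycleM J qs i phi (a : S) :
  is_ideal J -> kcycle J qs i phi -> kcycle J qs i (fun s => a * phi s).
Proof.
by move=> hJ h s hs hc; rewrite kdiffM; apply: idealM => //; apply: h.
Qed.

(** The multipliers c that turn the cycle into a boundary form an ideal, and [khomotopyP] puts each
    element of [qs] into it. *)
Lemma kbound_annihilated J qs i phi (c : S) :
  is_ideal J -> kcycle J qs i phi -> in_ideal qs c ->
  kbound J qs i (fun s => c * phi s).
Proof.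
move=> hJ hphi; move: c.
apply: (@in_ideal_sub _ _ qs (fun c => kbound J qs i (fun s => c * phi s))).
  split; [|split].
  - exists (fun=> 0) => s _ _; rewrite kdiff0 mul0r subrr; exact: ideal0.
  - move=> a b [psi1 h1] [psi2 h2].
    exists (fun t => psi1 t + 1 * psi2 t) => s hs hc; rewrite kdiffD.
    have -> : (a + b) * phi s - (kdiff qs psi1 s + 1 * kdiff qs psi2 s) =
      (a * phi s - kdiff qs psi1 s) + (b * phi s - kdiff qs psi2 s) by ring.
    by apply: idealD => //; [apply: h1|apply: h2].
  - move=> r a [psi h]; exists (fun t => r * psi t) => s hs hc; rewrite kdiffM.
    by rewrite -mulrA -mulrBr; apply: idealM => //; apply: h.
move=> q /(nthP 0)[j hj <-]; exists (khomotopy j phi) => s hs hc.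
rewrite -(khomotopyP phi hj hs) addrC addKr.
apply: khomotopy_ideal => // t ht hct; apply: hphi; first by rewrite ht.
by rewrite hct.
Qed.

(* The connecting map of 0 -> M -f-> M -> M/fM -> 0 shows that f is injective
   on the homology in degree i once the homology of M/fM vanishes in degree
   i + 1; but f is nilpotent there. *)
Lemma koszul_vanishing J qs fs i phi :
  is_ideal J -> regular J fs ->
  (forall f, f \in fs -> exists k, in_ideal qs (f ^+ k)) ->
  (size qs < i + size fs)%N -> kcycle J qs i phi -> kbound J qs i phi.
Proof.
elim: fs J i phi => [|f fs IH] J i phi hJ /=.
  move=> _ _; rewrite addn0 => hi _; exists (fun=> 0) => s hs hc.
  by have := count_size id s; rewrite hc hs leqNgt hi.
case=> hf hreg hnil hi hphi.
have inj chi : kcycle J qs i chi -> kbound J qs i (fun s => f * chi s) ->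
    kbound J qs i chi.
  move=> hchi [psi hpsi].
  have [|||||omega homega] := IH (adj J f) i.+1 psi.
  - exact: adj_ideal.
  - by [].
  - by move=> g hg; apply: hnil; rewrite inE hg orbT.
  - by rewrite addSnnS.
  - move=> s hs [hc]; exists (chi s); rewrite -opprB; apply: idealN => //.
    exact: hpsi.
  (* [rho] is the quotient of psi - d omega by f, meaningful only in degree i + 1. Then f chi = d
     psi = f d rho modulo J, and f cancels. *)
  pose rho t := epsilon (inhabits 0) (fun q => J (psi t - kdiff qs omega t - f * q)).
  have hrho t : size t = size qs -> count id t = i.+1 ->
      J (psi t - kdiff qs omega t - f * rho t).
    move=> ht hc; exact: (epsilon_spec (inhabits 0)
      (fun q => J (psi t - kdiff qs omega t - f * q)) (homega t ht hc)).
  exists rho => s hs hc; apply: hf.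
  have h1 : J (kdiff qs (fun t => (psi t + (-1) * kdiff qs omega t) + (- f) * rho t) s).
    apply: kdiff_ideal => // t ht hct.
    by rewrite mulN1r mulNr; apply: hrho; [rewrite ht|rewrite hct hc].
  rewrite !kdiffD kdiffK mulr0 addr0 in h1.
  have -> : f * (chi s - kdiff qs rho s) = (f * chi s - kdiff qs psi s) +
    (kdiff qs psi s + - f * kdiff qs rho s) by ring.
  by apply: idealD => //; apply: hpsi.
have [k hk] := hnil f (mem_head _ _).
have := kbound_annihilated hJ hphi hk.
(* Some f^k lies in the ideal of [qs], so f^k phi is a boundary; [inj] removes the factors f one at
   a time. *)
elim: k {hk} => [|k IHk] hb.
  by case: hb => psi hpsi; exists psi => s hs hc; have := hpsi s hs hc; rewrite mul1r.
apply: IHk; apply: inj; first exact: kcycleM.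
case: hb => psi hpsi; exists psi => s hs hc; have := hpsi s hs hc.
by rewrite exprS mulrA.
Qed.

Lemma radical_ideal K : is_ideal K -> is_ideal (fun p => exists k, K (p ^+ k)).
Proof.
move=> hK; split; [|split].
- by exists 1%N; rewrite expr1; apply: ideal0.
- move=> a b [k hk] [l hl]; exists (k + l)%N; rewrite exprDn.
  apply: ideal_sum => // i _; rewrite -mulr_natr; apply: idealMr => //.
  case: (leqP l i) => hi.
    by rewrite -[X in b ^+ X](subnK hi) exprD; do 2![apply: idealM => //].
  have -> : (k + l - i = k + (l - i))%N by lia.
  by rewrite exprD; do 2![apply: idealMr => //].
- by move=> r a [k hk]; exists k; rewrite exprMn; apply: idealM.
Qed.

Lemma regular_size_bound (D : pred {set 'I_n}) (T : {set 'I_n}) fs :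
  upclosed D -> ~~ D (~: T) -> (forall i, i \in T -> D (i |: ~: T)) ->
  regular (sqfree D) fs -> (forall f, f \in fs -> in_ideal (var_list F n) f) ->
  (size fs <= n - #|T|)%N.
Proof.
move=> hD hT hTD hreg hvar; rewrite leqNgt; apply/negP => hlt.
(* The variables of T make the chain x_W e_T a cycle modulo the ideal, W being the complement of T;
   the squares outside T keep it from being a boundary. *)
pose g i : S := if i \in T then 'X_i else 'X_i ^+ 2.
pose qs := [seq g i | i <- enum 'I_n].
pose sT : bitseq := [seq i \in T | i <- enum 'I_n].
pose u : S := 'X_[mesym1 (~: T)].
have hs : size qs = n by rewrite size_map size_enum_ord.
have hsT : size sT = n by rewrite size_map size_enum_ord.
have qsE (i : 'I_n) : qs`_i = g i.
  by rewrite (nth_map i) ?size_enum_ord // nth_ord_enum.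
have sTE (i : 'I_n) : nth false sT i = (i \in T).
  by rewrite (nth_map i) ?size_enum_ord // nth_ord_enum.
have hcT : count id sT = #|T|.
  rewrite count_map cardE -size_filter; congr size.
  by rewrite {2}/enum_mem -enumT; apply: eq_filter.
have suppu : mnm_supp (mesym1 (~: T)) = ~: T.
  by apply/setP=> i; rewrite inE mnmE; case: (i \in _).
have hJ : is_ideal (sqfree D : S -> Prop) := sqfree_ideal F hD.
have [||||psi hpsi] := @koszul_vanishing _ qs fs #|T|
    (fun s => if s == sT then u else 0) hJ.
- exact: hreg.
- move=> f hf; have: in_ideal (var_list F n) f by apply: hvar.
  apply: (in_ideal_sub (K := fun p => exists k, in_ideal qs (p ^+ k))).
    exact/radical_ideal/in_ideal_ideal.
  move=> x /mapP[i _ ->]; exists 2%N.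
  have hg : in_ideal qs (g i) by apply/in_ideal_mem/map_f; rewrite mem_enum.
  move: hg; rewrite /g; case: ifP => // _ hg.
  by rewrite expr2; apply: idealM => //; apply: in_ideal_ideal.
- rewrite hs; have := max_card (mem T); rewrite card_ord; lia.
- move=> s hss hc; apply: kdiff_mem => // j hj hjs hsj.
  case: eqP => [E|_]; last by rewrite mulr0; apply: ideal0.
  rewrite hs in hj; pose i := Ordinal hj; rewrite -[j]/(val i) qsE.
  have hi : i \in T by rewrite -sTE -E nth_set_nth /= eqxx.
  rewrite /g hi /u -mpolyXD; apply/sqfreeX.
  by rewrite mnm_suppD mnm_suppU suppu; apply: hTD.
(* [K] is the monomial ideal generated by [sqfree D] and all squares of variables. A boundary at the
   index T involves only the elements of [qs] outside T, which are squares, so it lies in [K]; the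
   squarefree monomial [u] does not. *)
pose K (p : S) := forall m, m \in msupp p -> D (mnm_supp m) \/ exists i, (1 < m i)%N.
have hK : is_ideal K.
  split; [|split].
  - by move=> m; rewrite msupp0.
  - move=> a b ha hb m /msuppD_le; rewrite mem_cat => /orP[]; [exact: ha|exact: hb].
  - move=> r a ha m /msuppM_le /allpairsP[[m1 m2] /= [_ h2 ->]].
    case: (ha _ h2) => [h|[i hi]].
      by left; apply: hD h; rewrite mnm_suppD subsetUr.
    by right; exists i; rewrite mnmDE; lia.
have hu : K u.
  have h := hpsi sT; rewrite hsT hs eqxx in h.
  apply: (ideal_trans hK (q := kdiff qs psi sT)); last first.
    by move=> m hm; left; apply: (h erefl hcT m hm).
  apply: (kdiff_mem hK) => j hj _; rewrite hs in hj.
  pose i := Ordinal hj; rewrite -[j]/(val i) qsE sTE /g => /negbTE ->.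
  apply: (idealMr _ hK) => m; rewrite mpolyXn msuppX inE => /eqP->.
  by right; exists i; rewrite mulmnE mnm1E eqxx.
have [|h|[i]] := hu (mesym1 (~: T)); first by rewrite msuppX mem_head.
  by move: hT; rewrite -suppu h.
by rewrite mnmE; case: (i \in _).
Qed.

End Koszul.

(** * Dimension of the polynomial ring *)

Section PolynomialDimension.
Variables (F : fieldType) (n : nat).
Local Notation S := {mpoly F[n]}.
Implicit Types (Ps : nat -> S -> Prop) (ys : seq S).

(* The monomial in ys whose exponents are the base-N digits of k. *)
Fixpoint digit_mono (N : nat) ys (k : nat) : S :=
  if ys is y :: ys' then y ^+ (k %% N) * digit_mono N ys' (k %/ N) else 1.

Lemma sum_digits (N m : nat) (G : nat -> S) :
  \sum_(k < m * N) G k = \sum_(a < N) \sum_(k < m) G (k * N + a)%N.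
Proof.
rewrite exchange_big /=; elim: m => [|m IH]; first by rewrite !big_ord0.
rewrite big_ord_recr /= -IH mulSn addnC -!(big_mkord xpredT).
rewrite (big_cat_nat (n := m * N)) ?leq_addr //=; congr (_ + _).
rewrite -{1}[(m * N)%N]add0n big_addn addKn !big_mkord.
by apply: eq_bigr => a _; rewrite addnC.
Qed.

(** Modulo P1 only the constant term of the relation remains, so A 0 lies in P1 and vanishes; modulo
    the prime P0 the factor y then cancels from the rest. *)
Lemma power_independent (P0 P1 : S -> Prop) (y : S) (M : nat) (A : nat -> S) :
  is_prime P0 -> is_ideal P1 -> subideal P0 P1 -> P1 y -> ~ P0 y ->
  (forall a, P1 (A a) -> A a = 0) ->
  P0 (\sum_(a < M) y ^+ a * A a) -> forall a, (a < M)%N -> A a = 0.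
Proof.
move=> hP0 hP1 h01 hy1 hy0; elim: M A => [//|M IH] A hA.
rewrite big_ord_recl mul1r.
have E : \sum_(i < M) y ^+ lift ord0 i * A (lift ord0 i) =
    y * \sum_(i < M) y ^+ i * A i.+1.
  by rewrite mulr_sumr; apply: eq_bigr => i _; rewrite exprS mulrA.
rewrite E => h.
have A0 : A 0%N = 0.
  apply: hA; rewrite -[A 0%N](addrK (y * \sum_(i < M) y ^+ i * A i.+1)).
  by apply: idealB => //; [apply: h01|apply: idealMr].
case=> // a ha; apply: (IH (fun a => A a.+1)) ha => [b|]; first exact: hA.
by move: h; rewrite A0 add0r => /(prime_nzd hP0 hy0).
Qed.

(** Grouping by the exponent of the first element gives a polynomial in it whose coefficients are
    combinations of the remaining digit monomials. By induction on the chain from [Ps 1] on, such a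
    coefficient lies in [Ps 1] only if it is trivial, as [power_independent] asks. *)
Lemma digit_mono_independent (N : nat) ys Ps (c : nat -> F) :
  (0 < N)%N ->
  (forall i, (i <= size ys)%N -> is_prime (Ps i)) ->
  (forall i, (i < size ys)%N ->
     [/\ subideal (Ps i) (Ps i.+1), Ps i.+1 ys`_i & ~ Ps i ys`_i]) ->
  Ps 0%N (\sum_(k < N ^ size ys) c k *: digit_mono N ys k) ->
  forall k, (k < N ^ size ys)%N -> c k = 0.
Proof.
move=> hN; elim: ys Ps c => [|y ys IH] Ps c hP hy.
  rewrite expn0 big_ord1 /= => h [|//] _.
  have [hI [h1 _]] := hP 0%N (leqnn _).
  apply/eqP; apply: contra_notT h1 => hc.
  rewrite -[1](scalerK hc) -mul_mpolyC; exact: idealM.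
rewrite /= expnSr (sum_digits N _
  (fun k => c k *: (y ^+ (k %% N) * digit_mono N ys (k %/ N)))) => h k hk.
pose A a := \sum_(k < N ^ size ys) c (k * N + a)%N *: digit_mono N ys k.
have [h01 hy1 hy0] := hy 0%N (ltn0Sn _).
have hA a : Ps 1%N (A a) -> forall k, (k < N ^ size ys)%N -> c (k * N + a)%N = 0.
  apply: (IH (fun i => Ps i.+1) (fun k => c (k * N + a)%N)) => i hi.
    exact: hP.
  exact: (hy i.+1).
have hk' : (k %/ N < N ^ size ys)%N by rewrite ltn_divLR.
rewrite (divn_eq k N); apply: (hA _ _ _ hk').
have h1 : is_ideal (Ps 1%N) by case: (hP 1%N (ltn0Sn _)).
suff -> : A (k %% N)%N = 0 by apply: ideal0.
apply: (power_independent (hP 0%N (leq0n _)) h1 h01 hy1 hy0 (M := N)).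
- by move=> a /hA h0; apply: big1 => i _; rewrite h0 ?scale0r.
- congr (Ps 0%N _): h; apply: eq_bigr => a _; rewrite mulr_sumr.
  apply: eq_bigr => j _; rewrite -scalerAr modnMDl divnMDl //.
  by rewrite (divn_small (ltn_ord a)) (modn_small (ltn_ord a)) addn0.
- by rewrite ltn_mod.
Qed.

Definition deg_le (d : nat) (p : S) := forall m, m \in msupp p -> (mdeg m <= d)%N.

Lemma deg_leM d d' p q : deg_le d p -> deg_le d' q -> deg_le (d + d')%N (p * q).
Proof.
move=> hp hq m /msuppM_le /allpairsP[[m1 m2] /= [h1 h2 ->]].
by rewrite mdegD leq_add ?hp ?hq.
Qed.

Lemma deg_le1 d : deg_le d 1.
Proof. by move=> m; rewrite msupp1 inE => /eqP->; rewrite mdeg0. Qed.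

Lemma deg_leX d k p : deg_le d p -> deg_le (k * d) (p ^+ k).
Proof.
move=> hp; elim: k => [|k IH]; first exact: deg_le1.
by rewrite exprS mulSn; apply: deg_leM.
Qed.

Lemma deg_leW d d' p : (d <= d')%N -> deg_le d p -> deg_le d' p.
Proof. by move=> h hp m /hp hm; apply: leq_trans h. Qed.

Lemma deg_digit_mono N ys d k : (0 < N)%N ->
  (forall y, y \in ys -> deg_le d y) ->
  deg_le (size ys * (N * d)) (digit_mono N ys k).
Proof.
move=> hN; elim: ys k => [|y ys IH] k hys /=; first exact: deg_le1.
rewrite mulSn; apply: deg_leM.
  apply: deg_leW (deg_leX (k := k %% N) (hys y (mem_head _ _))).
  by rewrite leq_mul2r ltnW ?orbT // ltn_mod.
by apply: IH => z hz; apply: hys; rewrite inE hz orbT.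
Qed.

Lemma card_bmultinom b : (#|{: 'X_{1..n < b.+1}}| <= b.+1 ^ n)%N.
Proof.
have -> : (b.+1 ^ n = #|{ffun 'I_n -> 'I_b.+1}|)%N by rewrite card_ffun !card_ord.
pose h (m : 'X_{1..n < b.+1}) : {ffun 'I_n -> 'I_b.+1} := [ffun i => inord (m i)].
apply: (@leq_card _ _ h) => m1 m2 /ffunP E; apply/val_inj/mnmP => i.
have lt (m : 'X_{1..n < b.+1}) : (m i < b.+1)%N.
  apply: leq_ltn_trans (bmdeg m); rewrite mdegE (bigD1 i) //=.
  exact: leq_addr.
by have := congr1 (@nat_of_ord _) (E i); rewrite !ffunE !inordK.
Qed.

Lemma digit_mono_dependent ys : size ys = n.+1 ->
  exists (N : nat) (c : nat -> F), [/\ (0 < N)%N,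
    \sum_(k < N ^ n.+1) c k *: digit_mono N ys k = 0 &
    exists2 k, (k < N ^ n.+1)%N & c k != 0].
Proof.
move=> hys; pose d := (\max_(y <- ys) msize y)%N.
have hd y : y \in ys -> deg_le d y.
  move=> hy m /msize_mdeg_lt /ltnW hm; apply: leq_trans hm _.
  by rewrite /d (big_rem y) //= leq_maxl.
(* All N^(n+1) digit monomials have degree at most b, and b + 1 <= N((n+1)d + 1). The monomials of
   degree at most b number at most (b+1)^n <= N^n((n+1)d + 1)^n, which is below N^(n+1) by the
   choice of N. *)
pose N := ((n.+1 * d).+1 ^ n).+1; pose b := (n.+1 * (N * d))%N.
have hcard : (#|{: 'X_{1..n < b.+1}}| < N ^ n.+1)%N.
  apply: leq_ltn_trans (card_bmultinom b) _.
  have hb : (b.+1 <= N * (n.+1 * d).+1)%N.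
    rewrite /b mulnCA mulnS -addn1 addnC; exact: leq_add.
  apply: (@leq_ltn_trans ((N * (n.+1 * d).+1) ^ n)).
    have le_exp x y k : (x <= y -> x ^ k <= y ^ k)%N.
      by case: k => // k; rewrite leq_exp2r.
    exact: le_exp.
  rewrite expnMn expnSr ltn_pmul2l ?expn_gt0 //.
pose M : 'M[F]_(N ^ n.+1, #|{: 'X_{1..n < b.+1}}|) :=
  \matrix_(k, m) (digit_mono N ys k)@_(enum_val m : 'X_{1..n < b.+1}).
have hker : kermx M != 0.
  rewrite -mxrank_eq0 mxrank_ker subn_eq0 -ltnNge.
  exact: leq_ltn_trans (rank_leq_col _) hcard.
have [v /sub_kermxP hv nv] := rowV0Pn hker.
have [k hk] : exists k, v 0 k != 0.
  apply/existsP; apply: contraNT nv; rewrite negb_exists => /forallP h.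
  by apply/eqP/rowP => k; rewrite mxE; apply/eqP; have := h k; rewrite negbK.
exists N, (fun k => if insub k is Some k' then v 0 k' else 0); split=> //.
  apply/mpolyP => m; rewrite mcoeff0 raddf_sum /=.
  have [hm|hm] := ltnP (mdeg m) b.+1.
    pose m' : 'X_{1..n < b.+1} := BMultinom hm.
    have := congr1 (fun A : 'rV_ _ => A 0 (enum_rank m')) hv; rewrite !mxE => E.
    rewrite -[RHS]E; apply: eq_bigr => j _.
    by rewrite valK mcoeffZ !mxE enum_rankK.
  apply: big1 => j _; rewrite mcoeffZ memN_msupp_eq0 ?mulr0 //.
  apply/negP => /(deg_digit_mono (ltn0Sn _ : (0 < N)%N) hd).
  by rewrite hys leqNgt hm.
by exists k => //; rewrite valK.
Qed.

Theorem prime_chain_bound Ps l : prime_chain Ps l -> (l <= n)%N.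
Proof.
case=> hP hs; rewrite leqNgt; apply/negP => hl.
pose y i := epsilon (inhabits (0 : S)) (fun x => Ps i.+1 x /\ ~ Ps i x).
have hy i : (i < n.+1)%N -> Ps i.+1 (y i) /\ ~ Ps i (y i).
  move=> hi; have [_ h] := hs i (leq_trans hi hl).
  exact: (epsilon_spec (inhabits (0 : S)) (fun x => Ps i.+1 x /\ ~ Ps i x) h).
have [|N [c [hN h0 [k hk /eqP hc]]]] := @digit_mono_dependent (mkseq y n.+1).
  by rewrite size_mkseq.
apply: hc; apply: (@digit_mono_independent N (mkseq y n.+1) Ps);
  rewrite ?size_mkseq //.
- by move=> i hi; apply: hP; apply: leq_trans hi hl.
- move=> i hi; rewrite nth_mkseq //; have [h1 h2] := hy i hi; split=> //.
  by case: (hs i (leq_trans hi hl)).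
- by rewrite h0; case: (hP 0%N (leq0n _)) => hI _; apply: ideal0.
Qed.

End PolynomialDimension.

(** * Prime ideals over an edge ideal *)

Section VariablePrimes.
Variables (F : fieldType) (n : nat).
Local Notation S := {mpoly F[n]}.
Local Notation vprime := (@vprime F n).
Implicit Types (P Q : S -> Prop) (Ps : nat -> S -> Prop) (T A B : {set 'I_n}).

Definition set_prefix B k : {set 'I_n} := [set x in take k (enum B)].

Lemma set_prefix_full B : set_prefix B #|B| = B.
Proof. by apply/setP=> x; rewrite inE take_oversize ?mem_enum // -cardE. Qed.

Lemma set_prefix0 B : set_prefix B 0 = set0.
Proof. by apply/setP=> x; rewrite !inE take0. Qed.

Lemma vprime_strict T T' i :
  T \subset T' -> i \in T' -> i \notin T -> strict_subideal (vprime T) (vprime T').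
Proof.
move=> hT hi hi'; split; first exact: vprime_subset.
by exists 'X_i; rewrite !vprimeX; split=> //; apply/negP.
Qed.

Lemma vprime_chain A B : [disjoint A & B] ->
  prime_chain (fun i => vprime (A :|: set_prefix B i)) #|B|.
Proof.
move=> hAB; split=> i hi; first exact: vprime_prime.
have hs : (i < size (enum B))%N by rewrite -cardE.
have [x0 hx0] : exists x0, x0 \in B by apply/set0Pn; rewrite -card_gt0; lia.
pose x := nth x0 (enum B) i.
have hx : x \in B by rewrite -mem_enum mem_nth.
apply: (@vprime_strict _ _ x).
- apply: setUS; apply/subsetP => y; rewrite !inE => hy.
  by rewrite (take_nth x0) // mem_rcons inE hy orbT.
- by rewrite !inE (take_nth x0) // mem_rcons mem_head orbT.
- rewrite !inE negb_or (disjointFl hAB hx) /=.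
  by rewrite in_take ?mem_nth // index_uniq ?enum_uniq // ltnn.
Qed.

Lemma disjoint_set0 T : [disjoint (set0 : {set 'I_n}) & T].
Proof. by rewrite disjoints_subset sub0set. Qed.

(** A chain of length |T| from 0 up to (x_T) is placed below the given one, and the total length is
    at most n. *)
Lemma chain_from_vprime Ps l T :
  prime_chain Ps l -> subideal (vprime T) (Ps 0%N) -> (l + #|T| <= n)%N.
Proof.
move=> [hP hs] h0; apply: (@prime_chain_bound F n
  (fun i => if (i < #|T|)%N then vprime (set0 :|: set_prefix T i) else Ps (i - #|T|)%N)).
have [_ hv] := vprime_chain (disjoint_set0 T).
split=> i hi.
  by case: ltnP => hiT; [apply: vprime_prime|apply: hP; lia].
case: (ltnP i #|T|) => hiT; last first.
  by rewrite ltnNge leqW //= subSn //; apply: hs; rewrite ltn_subLR // addnC.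
case: ltnP => hiT'; first exact: hv.
(* At the junction (x_T) is replaced by [Ps 0], which contains it and may equal it; the last
   inclusion remains strict. *)
have E : i.+1 = #|T| by lia.
have := hv i hiT; rewrite E set_prefix_full [set0 :|: T]set0U => -[h1 [x [hx nx]]].
rewrite subnn; split; first by move=> p hp; apply: h0; apply: h1.
by exists x; split=> //; apply: h0.
Qed.

(** Adjoining the n - |T| other variables one by one prolongs the chain up to the maximal ideal, and
    the total length is at most n. *)
Lemma chain_to_vprime Ps l T :
  prime_chain Ps l -> (forall p, Ps l p <-> vprime T p) -> (l <= #|T|)%N.
Proof.
move=> [hP hs] /pred_ext hl.
have hd : [disjoint T & ~: T] by rewrite disjoints_subset setCK.
have [_ hv] := vprime_chain hd.
suff : (l + #|~: T| <= n)%N by have := cardsC T; rewrite card_ord; lia.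
apply: (@prime_chain_bound F n
  (fun i => if (i < l)%N then Ps i else vprime (T :|: set_prefix (~: T) (i - l)%N))).
split=> i hi.
  by case: ltnP => hil; [apply: hP; lia|apply: vprime_prime].
case: (ltnP i l) => hil; last first.
  by rewrite ltnNge leqW //= subSn //; apply: hv; rewrite ltn_subLR.
case: ltnP => hil'; first exact: hs.
have E : i.+1 = l by lia.
by have := hs i hil; rewrite E subnn set_prefix0 setU0 hl.
Qed.

Lemma height_vprime T : height_is (vprime T) #|T|.
Proof.
split; last by move=> Ps l; apply: chain_to_vprime.
exists (fun i => vprime (set0 :|: set_prefix T i)); split.
  exact/vprime_chain/disjoint_set0.
by move=> x; rewrite set0U set_prefix_full.
Qed.

Lemma height_uniq P h h' : height_is P h -> height_is P h' -> h = h'.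
Proof.
move=> [[Ps [h1 h2]] hm] [[Qs [h1' h2']] hm'].
by apply/eqP; rewrite eqn_leq (hm' Ps) // (hm Qs).
Qed.

Lemma regular_variables T (s : seq 'I_n) :
  uniq s -> (forall i, i \in s -> i \notin T) ->
  regular (vprime T) [seq 'X_i | i <- s].
Proof.
elim: s T => [//|i s IH] T /= /andP[his hu] hs; split.
  apply: prime_nzd; first exact: vprime_prime.
  by rewrite vprimeX; apply/negP/hs; rewrite mem_head.
rewrite adj_vprime; apply: IH => // j hj.
rewrite !inE negb_or hs ?inE ?hj ?orbT // andbT.
by apply: contraNneq his => <-.
Qed.

End VariablePrimes.

(** * Minimal primes of an edge ideal, and bounds from independent dominating sets *)

Section EdgeIdealPrimes.
Variables (F : fieldType) (n : nat) (e : rel 'I_n).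
Hypothesis he : simple_graph e.
Local Notation S := {mpoly F[n]}.
Local Notation I := (@edge_ideal F n e).
Local Notation vprime := (@vprime F n).
Implicit Types (P Q : S -> Prop) (C W A : {set 'I_n}).

Lemma independentP A :
  reflect (forall x y, x \in A -> y \in A -> ~~ e x y) (independent e A).
Proof.
apply: (iffP forall_inP) => [h x y hx hy|h x hx].
  by have /forall_inP := h x hx; apply.
by apply/forall_inP => y; apply: h.
Qed.

Lemma dominatingP A :
  reflect (forall x, x \notin A -> exists2 y, y \in A & e x y) (dominating e A).
Proof.
apply: (iffP forallP) => [h x hx|h x].
  by have /implyP/(_ hx)/exists_inP := h x.
by apply/implyP => hx; apply/exists_inP/h.
Qed.

Lemma independent_edge_dep A : independent e A = ~~ edge_dep e A.
Proof.
apply/independentP/idP => [h|h x y hx hy].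
  by apply/negP => /edge_depP[a [b [ha hb hab]]]; have := h a b ha hb; rewrite hab.
by apply: contraNN h => hxy; apply/edge_depP; exists x, y.
Qed.

Lemma edge_ideal_sub_vprime C : independent e (~: C) -> subideal I (vprime C).
Proof.
rewrite independent_edge_dep edge_idealE // => hC p hp m /hp hm.
apply: contraNneq hC => h0; apply: edge_dep_up hm.
by rewrite -disjoints_subset -setI_eq0 h0.
Qed.

Lemma prime_variables Q : exists C, forall i, i \in C <-> Q 'X_i.
Proof.
have [f hf] : exists f : 'I_n -> bool, forall i, f i <-> Q 'X_i.
  apply: (fin_all_exists (P := fun i (b : bool) => b <-> Q 'X_i)) => i.
  by case: (classic (Q 'X_i)) => h; [exists true|exists false]; split.
by exists [set i | f i] => i; rewrite inE.
Qed.

Lemma prime_over_edge_ideal Q : is_prime Q -> subideal I Q ->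
  exists C, [/\ forall i, i \in C <-> Q 'X_i, independent e (~: C) &
                subideal (vprime C) Q].
Proof.
move=> hQ hIQ; have [C hC] := prime_variables Q; exists C; split=> //.
  apply/independentP => x y; rewrite !inE => hx hy; apply/negP => hxy.
  case: hQ => _ [_ hQ]; have : Q ('X_x * 'X_y).
    apply: hIQ; apply: in_ideal_mem; apply/mapP; exists (x, y) => //.
    by rewrite mem_enum.
  by case/hQ => /hC; apply/negP.
by apply: vprime_sub; [case: hQ|move=> i /hC].
Qed.

Lemma indep_dominating_minimal W C :
  independent e W -> dominating e W -> W \subset C -> independent e C -> C = W.
Proof.
move=> /independentP hW /dominatingP hdom hWC /independentP hC.
apply/eqP; rewrite eqEsubset hWC andbT; apply/subsetP => x hx.
apply: contraT => /hdom[y hy hxy].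
by have := hC x y hx (subsetP hWC _ hy); rewrite hxy.
Qed.

Lemma vprime_minimal W : independent e W -> dominating e W ->
  minimal_prime I (vprime (~: W)).
Proof.
move=> hW hdom; split; first exact: vprime_prime; split.
  by apply: edge_ideal_sub_vprime; rewrite setCK.
move=> Q hQ hIQ hQP; have [C [hC hCi hCQ]] := prime_over_edge_ideal hQ hIQ.
have E : ~: C = W.
  apply: indep_dominating_minimal => //; apply/subsetP => i hi.
  by rewrite inE; apply/negP => /hC/hQP/vprimeX; rewrite inE hi.
by rewrite -E setCK.
Qed.

Lemma minimal_prime_vprime P : minimal_prime I P ->
  exists W, [/\ independent e W, dominating e W & P = vprime (~: W)].
Proof.
move=> [hP [hIP hmin]]; have [C [hC hCi hCP]] := prime_over_edge_ideal hP hIP.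
exists (~: C); split=> //; last first.
  rewrite setCK; apply: pred_ext => p; split; last exact: hCP.
  by apply: hmin => //; [apply: vprime_prime|apply: edge_ideal_sub_vprime].
apply/dominatingP => x hx; apply/exists_inP; apply: contraT => hno.
have hx' : x \in C by move: hx; rewrite inE negbK.
(* If x has no neighbour outside the cover C, then C without x is still a cover and gives a smaller
   prime over the ideal. *)
have hxC : independent e (~: (C :\ x)).
  apply/independentP => a b; rewrite !inE !negb_and !negbK => ha hb.
  have hn y : y \notin C -> ~~ e x y.
    by move=> hy; apply: contraNN hno => hxy; apply/exists_inP; exists y; rewrite ?inE.
  case/orP: ha => [/eqP->|ha]; case/orP: hb => [/eqP->|hb].
  - by rewrite he.2.
  - exact: hn.
  - by rewrite he.1; apply: hn.
  - by move/independentP: hCi; apply; rewrite inE.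
have := hmin _ (vprime_prime F (C :\ x)) (edge_ideal_sub_vprime hxC).
have hsub : subideal (vprime (C :\ x)) P.
  move=> p hp; apply: hCP; exact: (vprime_subset (subsetDl C [set x])).
have /hC hxP := hx'.
by move=> /(_ hsub _ hxP)/vprimeX; rewrite !inE eqxx.
Qed.

Lemma independent_extend A : independent e A ->
  exists W, [/\ A \subset W, independent e W & dominating e W].
Proof.
move=> hA; pose Q W := (A \subset W) && independent e W.
have hQ : Q A by rewrite /Q subxx.
case: (arg_maxnP (fun W : {set 'I_n} => #|W|) hQ) => W /andP[hAW hW] hmax.
exists W; split=> //; apply/dominatingP => x hx; apply/exists_inP.
apply: contraT => hno.
have hn y : y \in W -> ~~ e x y.
  by move=> hy; apply: contraNN hno => hxy; apply/exists_inP; exists y.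
suff /hmax : Q (x |: W) by rewrite /geq /= cardsU1 hx add1n ltnn.
rewrite /Q (subset_trans hAW) ?subsetUr //=; apply/independentP => a b.
rewrite !inE => /orP[/eqP->|ha] /orP[/eqP->|hb].
- by rewrite he.2.
- exact: hn.
- by rewrite he.1; apply: hn.
- by move/independentP: hW; apply.
Qed.

Lemma free_res_bound W r : independent e W -> dominating e W ->
  has_free_res I r -> (n - #|W| <= r)%N.
Proof.
move=> hW hdom [R _].
have <- : size [seq 'X_i : S | i <- enum (~: W)] = (n - #|W|)%N.
  by rewrite size_map -cardE [#|~: W|]cardsCs setCK card_ord.
have suppu : mnm_supp (mesym1 W) = W.
  by apply/setP=> i; rewrite inE mnmE; case: (i \in _).
apply: (regular_annihilator_bound R (u := 'X_[mesym1 W])).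
- exact: edge_ideal_ideal.
- rewrite -(vprime0 F n); apply: regular_variables; first exact: enum_uniq.
  by move=> i _; rewrite inE.
- move=> q /mapP[i]; rewrite mem_enum inE => hi ->.
  rewrite edge_idealE // -mpolyXD; apply/sqfreeX/edge_depP.
  have /dominatingP/(_ i hi)[y hy hiy] := hdom; exists i, y.
  by rewrite mnm_suppD mnm_suppU suppu !inE eqxx hy orbT.
- rewrite edge_idealE // sqfreeX suppu; apply/negP.
  by rewrite -independent_edge_dep.
Qed.

Lemma edge_regular_seq_bound W fs : independent e W -> dominating e W ->
  regular_seq I fs -> (size fs <= #|W|)%N.
Proof.
move=> hW hdom [hvar [/regularP hreg _]].
have -> : #|W| = (n - #|~: W|)%N by rewrite cardsCs card_ord.
apply: (regular_size_bound (D := edge_dep e)) hvar.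
- exact: edge_dep_up.
- by rewrite setCK -independent_edge_dep.
- rewrite setCK => i; rewrite inE => hi; apply/edge_depP.
  have /dominatingP/(_ i hi)[y hy hiy] := hdom; exists i, y.
  by rewrite !inE eqxx hy orbT.
- by rewrite -edge_idealE.
Qed.

End EdgeIdealPrimes.

(** * Domination parameters and the induction *)

Section DominationNumbers.

Lemma bigminn_le (I : finType) (P : pred I) (h : I -> nat) (N : nat) i :
  P i -> (\big[minn/N]_(j | P j) h j <= h i)%N.
Proof.
move=> hi; have := mem_index_enum i; elim: index_enum => //= j r IH.
rewrite inE big_cons => /predU1P[<-|/IH hr]; first by rewrite hi geq_minl.
by case: (P j); rewrite // geq_min hr orbT.
Qed.

Lemma bigminn_le_default (I : finType) (P : pred I) (h : I -> nat) (N : nat) :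
  (\big[minn/N]_(j | P j) h j <= N)%N.
Proof.
by elim/big_rec: _ => // i x _ hx; rewrite geq_min hx orbT.
Qed.

Lemma bigminn_attained (n : nat) (P : pred {set 'I_n}) :
  (exists A, P A) -> exists2 A, P A & \big[minn/n]_(A | P A) #|A| = #|A|.
Proof.
case=> A0 hA0; set v := \big[_/_]_(_ | _) _.
have [//|E] : (exists2 A, P A & v = #|A|) \/ v = n.
  rewrite /v; apply: (big_ind (fun v => (exists2 A, P A & v = #|A|) \/ v = n)).
  - by right.
  - by move=> x y hx hy; rewrite /minn; case: ifP.
  - by move=> A hA; left; exists A.
(* When the minimum equals the default n, any admissible set attains it, having at most n
   elements. *)
exists A0 => //; apply/eqP; rewrite eqn_leq bigminn_le //= -/v E.
by rewrite -[X in (_ <= X)%N]card_ord max_card.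
Qed.

Variables (n : nat) (e : rel 'I_n).
Hypothesis he : simple_graph e.

Lemma gamma_le A : dominating e A -> (gamma e <= #|A|)%N.
Proof. exact: bigminn_le. Qed.

Lemma gamma_attained : exists2 A, dominating e A & gamma e = #|A|.
Proof.
apply: bigminn_attained; exists setT; apply/dominatingP => x.
by rewrite inE.
Qed.

Lemma idom_le A : independent e A -> dominating e A -> (idom e <= #|A|)%N.
Proof. by move=> h1 h2; apply: bigminn_le; rewrite h1. Qed.

Lemma idom_attained :
  exists A, [/\ independent e A, dominating e A & idom e = #|A|].
Proof.
have [|A /andP[h1 h2] h3] := @bigminn_attained n
    (fun A => independent e A && dominating e A); last by exists A.
have [|W [_ h1 h2]] := independent_extend he (A := set0).
  by apply/independentP => x y; rewrite inE.
by exists W; rewrite h1.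
Qed.

Lemma dominating_edgeless A :
  ~ has_edge e -> dominating e A -> #|A| = n.
Proof.
move=> hne /dominatingP h; rewrite -[RHS]card_ord -cardsT; congr #|pred_of_set _|.
apply/setP=> x; rewrite inE; apply: contraT => /h[y _ hxy].
by case: hne; exists x, y.
Qed.

Variables (m : nat) (v : 'I_n) (k : 'I_m -> 'I_n).
Hypothesis k_image : forall x, (exists a, k a = x) <-> x != v /\ ~~ e v x.
Let e' : rel 'I_m := fun a b => e (k a) (k b).

(** The map [k] places G - N[v] inside G; v dominates its neighbours and the copy of A dominates the
    rest. With [independent_star] and [card_star] this yields f(G) <= f(G - N[v]) + 1. *)
Lemma dominating_star A : dominating e' A -> dominating e (v |: k @: A).
Proof.
move=> /dominatingP h; apply/dominatingP => x.
rewrite !inE negb_or => /andP[hxv hx].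
case: (boolP (e v x)) => hvx.
  by exists v; rewrite ?inE ?eqxx // he.1.
have /k_image[a ha] : x != v /\ ~~ e v x by [].
have [|b hb hab] := h a.
  by apply: contraNN hx => haA; rewrite -ha imset_f.
by exists (k b); rewrite ?inE ?imset_f ?orbT // -ha.
Qed.

Lemma independent_star A : independent e' A -> independent e (v |: k @: A).
Proof.
move=> /independentP h; apply/independentP => x y.
have hv a : ~~ e v (k a) by have /k_image[] : exists a', k a' = k a by exists a.
rewrite !inE => /predU1P[->|/imsetP[a ha ->]] /predU1P[->|/imsetP[b hb ->]] //.
- by rewrite he.2.
- by rewrite he.1.
- exact: h.
Qed.

Lemma card_star (A : {set 'I_m}) : (#|v |: k @: A| <= #|A|.+1)%N.
Proof.
by rewrite cardsU1 -add1n leq_add ?leq_b1 ?leq_imset_card.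
Qed.

End DominationNumbers.

(** * Induction over induced subgraphs *)

Section DominationParameter.
Variable f : forall n : nat, rel 'I_n -> nat.
Hypothesis Hf : f = gamma \/ f = idom.

Lemma domination_le n (e : rel 'I_n) : (f e <= n)%N.
Proof. by case: Hf => ->; apply: bigminn_le_default. Qed.

Lemma domination_edgeless n (e : rel 'I_n) :
  simple_graph e -> ~ has_edge e -> f e = n.
Proof.
move=> he hne; case: Hf => ->.
  by have [A hA ->] := gamma_attained e; apply: dominating_edgeless hA.
by have [A [_ hA ->]] := idom_attained he; apply: dominating_edgeless hA.
Qed.

Lemma induced_simple n m (e : rel 'I_n) (k : 'I_m -> 'I_n) :
  simple_graph e -> simple_graph (fun a b => e (k a) (k b)).
Proof. by case=> h1 h2; split=> *. Qed.

Lemma domination_star n m (e : rel 'I_n) (v : 'I_n) (k : 'I_m -> 'I_n) :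
  simple_graph e -> (forall x, (exists a, k a = x) <-> x != v /\ ~~ e v x) ->
  (f e <= (f (fun a b : 'I_m => e (k a) (k b))).+1)%N.
Proof.
move=> he hk; case: Hf => ->.
  have [A hA ->] := gamma_attained (fun a b : 'I_m => e (k a) (k b)).
  exact: leq_trans (gamma_le (dominating_star he hk hA)) (card_star _ _ _).
have [A [hi hA ->]] := idom_attained (induced_simple k he).
apply: leq_trans (card_star v k A).
by apply: idom_le; [apply: independent_star|apply: dominating_star].
Qed.

Variable C : forall n : nat, rel 'I_n -> Prop.
Hypothesis Hher : forall (n : nat) (e : rel 'I_n.+1) (v : 'I_n.+1),
  simple_graph e -> C e -> C (del_vertex e v).

(** Vertices are deleted one at a time, each deletion relabelling the others; [k] is the composite
    of the relabellings. *)
Lemma hereditary_induced n (e : rel 'I_n) (B : {set 'I_n}) :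
  simple_graph e -> C e ->
  exists m (k : 'I_m -> 'I_n), [/\ injective k,
    forall x, (exists a, k a = x) <-> x \notin B,
    C (fun a b => e (k a) (k b)) & (n = m + #|B|)%N].
Proof.
have [N] := ubnP #|B|; elim: N n e B => // N IH n e B hB he hC.
have [E|[v hv]] := set_0Vmem B.
  exists n, id; split=> //; last by rewrite E cards0 addn0.
  by move=> x; rewrite E inE; split=> // _; exists x.
case: n e B v hB he hC hv => [|n] e B v hB he hC hv; first by case: v hv.
pose B' := [set a | lift v a \in B].
have hB' : #|B| = #|B'|.+1.
  rewrite (cardsD1 v) hv add1n; congr _.+1.
  rewrite -(card_imset _ (@lift_inj _ v)); congr #|pred_of_set _|.
  apply/setP=> x; rewrite !inE; apply/andP/imsetP.
    case=> hxv hx; case: (unliftP v x) hxv hx => [a ->|->]; last by rewrite eqxx.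
    by move=> _ ha; exists a; rewrite ?inE.
  by case=> a; rewrite inE => ha ->; rewrite eq_sym neq_lift.
have [|m [k [k_inj hk hCk hm]]] := IH n (del_vertex e v) B' _
  (induced_simple (lift v) he) (Hher v he hC); first by rewrite hB' in hB.
exists m, (lift v \o k); split.
- exact: inj_comp (@lift_inj _ v) k_inj.
- move=> x; split=> [[a <-]|hx] /=.
    have : k a \notin B' by apply/hk; exists a.
    by rewrite inE.
  case: (unliftP v x) hx => [a ->|->]; last by rewrite hv.
  move=> ha; have /hk[b hb] : a \notin B' by rewrite inE.
  by exists b; rewrite /= hb.
- exact: hCk.
- by rewrite hB' addnS -hm.
Qed.

Hypothesis Hdel : forall (n : nat) (e : rel 'I_n.+1),
  simple_graph e -> C e -> has_edge e ->
  exists v : 'I_n.+1, (f e <= f (del_vertex e v))%N.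

Variables (F : fieldType) (n : nat).
Local Notation S := {mpoly F[n]}.
(** The induction runs for two properties: a resolution of length at most r, and regularity of the
    first n - r elementary symmetric polynomials. *)
Variable Phi : (S -> Prop) -> nat -> Prop.
Hypothesis PhiW : forall J r r', (r <= r')%N -> Phi J r -> Phi J r'.
Hypothesis Phi_vprime : forall T, Phi (@vprime F n T) #|T|.
Hypothesis Phi_split : forall (D : pred {set 'I_n}) (i : 'I_n) r, upclosed D ->
  Phi (colon (sqfree D) 'X_i) r -> Phi (adj (sqfree D) 'X_i) r ->
  Phi (sqfree D) r.

(* The nonfaces of (x_T) + I(e), for the graph e placed on the variables
   selected by k; the remaining variables are free. *)
Definition embedded_dep m (e : rel 'I_m) (k : 'I_m -> 'I_n) (T : {set 'I_n}) :
    pred {set 'I_n} :=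
  fun A => (A :&: T != set0) || [exists a, exists b, [&& e a b, k a \in A & k b \in A]].

Lemma embedded_depP m (e : rel 'I_m) (k : 'I_m -> 'I_n) (T A : {set 'I_n}) :
  reflect ((exists2 i, i \in A & i \in T) \/
           exists a b, [/\ e a b, k a \in A & k b \in A]) (embedded_dep e k T A).
Proof.
apply: (iffP orP) => -[h|h]; [left|right|left|right].
- by case/set0Pn: h => i; rewrite inE => /andP[h1 h2]; exists i.
- by case/existsP: h => a /existsP[b /and3P[h1 h2 h3]]; exists a, b.
- by case: h => i h1 h2; apply/set0Pn; exists i; rewrite inE h1.
- case: h => a [b [h1 h2 h3]]; apply/existsP; exists a; apply/existsP; exists b.
  exact/and3P.
Qed.

Lemma embedded_dep_up m (e : rel 'I_m) (k : 'I_m -> 'I_n) T :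
  upclosed (embedded_dep e k T).
Proof.
move=> A B /subsetP hAB /embedded_depP h; apply/embedded_depP.
case: h => [[i h1 h2]|[a [b [h1 h2 h3]]]].
  by left; exists i; first exact: hAB.
by right; exists a, b; split=> //; apply: hAB.
Qed.

Lemma embedded_del m (e : rel 'I_m.+1) (k : 'I_m.+1 -> 'I_n) T v :
  simple_graph e ->
  (fun A : {set 'I_n} => (k v \in A) || embedded_dep e k T A) =
  embedded_dep (del_vertex e v) (k \o lift v) (k v |: T).
Proof.
move=> he; apply: functional_extensionality => A; apply/orP/embedded_depP.
  case=> [hv|/embedded_depP[[i h1 h2]|[a [b [h1 h2 h3]]]]].
  - by left; exists (k v); rewrite // !inE eqxx.
  - by left; exists i; rewrite // !inE h2 orbT.
  - case: (unliftP v a) h1 h2 => [a' ->|->] h1 h2; last first.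
      by left; exists (k v); rewrite // !inE eqxx.
    case: (unliftP v b) h1 h3 => [b' ->|->] h1 h3; last first.
      by left; exists (k v); rewrite // !inE eqxx.
    by right; exists a', b'.
case=> [[i h1]|[a [b [h1 h2 h3]]]].
  rewrite !inE => /predU1P[<-|h2]; first by left.
  by right; apply/embedded_depP; left; exists i.
by right; apply/embedded_depP; right; exists (lift v a), (lift v b).
Qed.

(** In the colon by x_v the neighbours of v become generators and absorb every edge that meets them,
    v becomes a free variable, and the edges of G - N[v] remain. *)
Lemma embedded_link m m' (e : rel 'I_m) (k : 'I_m -> 'I_n) (T : {set 'I_n}) v
    (k' : 'I_m' -> 'I_m) :
  simple_graph e -> injective k -> (forall a, k a \notin T) ->
  (forall x, (exists a, k' a = x) <-> x != v /\ ~~ e v x) ->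
  (fun A : {set 'I_n} => embedded_dep e k T (k v |: A)) =
  embedded_dep (fun a b => e (k' a) (k' b)) (k \o k') (T :|: k @: [set x | e v x]).
Proof.
move=> he k_inj kT hk'; apply: functional_extensionality => A.
apply/embedded_depP/embedded_depP.
  case=> [[i]|[a [b [h1 h2 h3]]]].
    rewrite !inE => /predU1P[->|h1 h2]; first by rewrite (negbTE (kT v)).
    by left; exists i; rewrite // inE h2.
  have nb x : e v x -> k x \in A ->
      exists2 i, i \in A & i \in T :|: k @: [set x | e v x].
    by move=> hx hA; exists (k x); rewrite // inE imset_f ?orbT // inE.
  move: h2 h3; rewrite !inE !(inj_eq k_inj).
  case: (eqVneq a v) h1 => [->|hav] h1 /=.
    case: (eqVneq b v) h1 => [->|hbv] h1 /=; first by rewrite he.2 in h1.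
    by move=> _ hb; left; apply: nb hb.
  move=> ha; case: (eqVneq b v) h1 => [->|hbv] h1 /=.
    by move=> _; left; apply: nb ha; rewrite he.1.
  move=> hb; case: (boolP (e v a)) => hva; first by left; apply: nb ha.
  case: (boolP (e v b)) => hvb; first by left; apply: nb hb.
  have /hk'[a' ha'] : a != v /\ ~~ e v a by [].
  have /hk'[b' hb'] : b != v /\ ~~ e v b by [].
  by right; exists a', b'; rewrite /= ha' hb'.
case=> [[i h1]|[a [b [h1 h2 h3]]]].
  rewrite inE => /orP[h2|/imsetP[x]].
    by left; exists i; rewrite // !inE h1 orbT.
  rewrite inE => hx hi; right; exists v, x.
  by rewrite !inE eqxx -hi h1 orbT.
by right; exists (k' a), (k' b); rewrite !inE h1 h2 h3 !orbT.
Qed.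

(** The ambient ring stays fixed while the graph shrinks inside it. Without edges f equals m, the
    bound is |T|, and the ideal is (x_T). *)
Lemma domination_induction_embedded m (e : rel 'I_m) (k : 'I_m -> 'I_n)
    (T : {set 'I_n}) :
  simple_graph e -> C e -> injective k -> (forall a, k a \notin T) ->
  Phi (sqfree (embedded_dep e k T)) (m - f e + #|T|).
Proof.
have [N] := ubnP m; elim: N m e k T => // N IH m e k T hN he hC k_inj kT.
have [hedge|hne] := classic (has_edge e); last first.
  rewrite domination_edgeless // subnn add0n.
  suff -> : sqfree (embedded_dep e k T) = @vprime F n T by [].
  congr sqfree; apply: functional_extensionality => A.
  rewrite /embedded_dep; case: (_ != set0) => //=.
  apply/negbTE/existsP => -[a /existsP[b /and3P[hab _ _]]].
  by apply: hne; exists a, b.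
case: m e k hN he hC k_inj kT hedge => [|m] e k hN he hC k_inj kT hedge.
  by case: hedge => -[].
have [v hv] := Hdel he hC hedge.
apply: (Phi_split (i := k v)); first exact: embedded_dep_up.
- rewrite colon_sqfree.
  have [m' [k' [k'_inj hk' hC' hm]]] :=
    hereditary_induced (v |: [set x | e v x]) he hC.
  have {}hk' x : (exists a, k' a = x) <-> x != v /\ ~~ e v x.
    by rewrite hk' !inE negb_or; split=> [/andP[]|[-> ->]].
  rewrite (embedded_link he k_inj kT hk').
  have hcard : (m.+1 = (m' + #|[set x | e v x]|).+1)%N.
    by rewrite {1}hm cardsU1 inE he.2 addnCA.
  apply: PhiW (IH m' (fun a b => e (k' a) (k' b)) (k \o k') _ _ _ _ _ _).
  (* With m' = |G - N[v]|, f' its parameter and N(v) the set of neighbours, m' - f' + |T| + |N(v)|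
     is within the bound because f <= f' + 1. *)
  + have := domination_star he hk'.
    have := domination_le (fun a b : 'I_m' => e (k' a) (k' b)).
    have := cardsUI T (k @: [set x | e v x]).
    rewrite (card_imset _ k_inj); lia.
  + by lia.
  + exact: induced_simple.
  + by [].
  + exact: inj_comp.
  + move=> a; rewrite inE negb_or kT /=; apply/imsetP => -[x].
    rewrite inE => hx /k_inj hax.
    have [_] : k' a != v /\ ~~ e v (k' a) by apply/hk'; exists a.
    by rewrite hax hx.
- rewrite adj_sqfree; last exact: embedded_dep_up.
  rewrite (embedded_del k T v he).
  apply: PhiW (IH m (del_vertex e v) (k \o lift v) _ _ _ _ _ _).
  (* T gains one variable and the graph loses one vertex, so the bound follows from f(G) <= f(G -
     v); f(G - v) <= m keeps the truncated subtraction exact. *)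
  + have := domination_le (del_vertex e v); rewrite cardsU1 kT.
    lia.
  + by lia.
  + exact: induced_simple.
  + exact: Hher.
  + exact: inj_comp (@lift_inj _ v).
  + move=> a; rewrite !inE negb_or kT andbT (inj_eq k_inj).
    by rewrite eq_sym neq_lift.
Qed.

Lemma domination_induction (e : rel 'I_n) :
  simple_graph e -> C e -> Phi (@edge_ideal F n e) (n - f e).
Proof.
move=> he hC; rewrite edge_idealE //.
have := @domination_induction_embedded n e id set0 he hC (@inj_id _).
rewrite cards0 addn0.
suff -> : embedded_dep e id set0 = edge_dep e by apply=> a; rewrite inE.
apply: functional_extensionality => A; apply/embedded_depP/edge_depP.
  by case=> [[i _]|[a [b [h1 h2 h3]]]]; [rewrite inE|exists a, b].
by case=> a [b [h1 h2 h3]]; right; exists a, b.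
Qed.

End DominationParameter.

(** * Projective dimension, big height and depth *)

Lemma ex_least (P : nat -> Prop) k :
  P k -> exists d, [/\ P d, (d <= k)%N & forall r, P r -> (d <= r)%N].
Proof.
elim/ltn_ind: k => k IH hk.
have [[r [hr hlt]]|hno] := classic (exists r, P r /\ (r < k)%N).
  have [d [h1 h2 h3]] := IH r hlt hr; exists d; split=> //.
  by apply: leq_trans h2 (ltnW hlt).
exists k; split=> // r hr; rewrite leqNgt; apply/negP => hlt.
by apply: hno; exists r.
Qed.

Section EdgeIdealInvariants.
Variables (F : fieldType) (n : nat).
Local Notation S := {mpoly F[n]}.

(** Iterated mapping cones: each variable is a nonzerodivisor modulo the prime generated by the
    others in T. *)
Lemma pdJ_le_vprime (T : {set 'I_n}) : pdJ_le #|T| (@vprime F n T).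
Proof.
have [N] := ubnP #|T|; elim: N T => // N IH T hT.
have [->|[i hi]] := set_0Vmem T.
  by rewrite cards0 vprime0; apply: pdJ_le_zero.
rewrite -(setD1K hi) -adj_vprime cardsU1 !inE eqxx add1n; apply: pdJ_le_cone.
- exact: vprime_ideal.
- by apply: prime_nzd; [apply: vprime_prime|rewrite vprimeX !inE eqxx].
- by apply: IH; rewrite (cardsD1 i) hi in hT.
Qed.

Lemma esyms_irrelevant k f : f \in esyms F n k -> in_ideal (var_list F n) f.
Proof.
case/mapP=> j _ ->; have hI := in_ideal_ideal (var_list F n).
apply: (ideal_sum _ hI) => h /eqP hh.
have [i hi] : exists i, i \in h by apply/set0Pn; rewrite -card_gt0 hh.
rewrite (bigD1 i) //=; apply: (idealMr _ hI); apply: in_ideal_mem.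
by apply: map_f; rewrite mem_enum.
Qed.

Lemma esyms_cat k l : (k <= l)%N -> exists fs, esyms F n l = esyms F n k ++ fs.
Proof.
move=> /subnKC <-; exists [seq mesym n F j.+1 | j <- iota k (l - k)].
by rewrite /esyms iotaD map_cat.
Qed.

Variable e : rel 'I_n.
Hypothesis he : simple_graph e.
Local Notation I := (@edge_ideal F n e).

Lemma esyms_regular_seq k : regular I (esyms F n k) -> regular_seq I (esyms F n k).
Proof.
move=> hreg; split; first exact: esyms_irrelevant.
split; first exact/regularP.
have hm := vprime_prime F [set: 'I_n]; case: (hm) => hmI [h1 _].
rewrite ideal_addE => h; apply: h1; move: h.
apply: foldl_adj_sub => //.
  apply: edge_ideal_sub_vprime => //; apply/independentP => x y.
  by rewrite setCT inE.
move=> f /esyms_irrelevant; apply: in_ideal_sub => // x /mapP[i _ ->].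
by apply/vprimeX; rewrite inE.
Qed.

Lemma bight_edge_ideal : bight_is I (n - idom e).
Proof.
have cardC (W : {set 'I_n}) : #|~: W| = (n - #|W|)%N.
  by rewrite [LHS]cardsCs setCK card_ord.
split.
  have [W [hW hdom ->]] := idom_attained he.
  exists (vprime (~: W)); split; first exact: vprime_minimal.
  by rewrite -cardC; apply: height_vprime.
move=> P h /(minimal_prime_vprime he)[W [hW hdom ->]] hh.
rewrite (height_uniq hh (height_vprime F (~: W))) cardC leq_sub2l //.
exact: idom_le.
Qed.

Lemma dim_le_independent Ps l : prime_chain Ps l -> subideal I (Ps 0%N) ->
  exists W, [/\ independent e W, dominating e W & (l <= #|W|)%N].
Proof.
move=> hPs h0; have hP0 : is_prime (Ps 0%N) by case: (hPs) => h _; apply: h.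
have [C [_ hC hCP]] := prime_over_edge_ideal hP0 h0.
have [W [hCW hW hdom]] := independent_extend he hC; exists W; split=> //.
apply: leq_trans (subset_leq_card hCW).
have := chain_from_vprime hPs hCP.
by rewrite -(leq_add2r #|C| l) [(#|~: C| + _)%N]addnC cardsC card_ord.
Qed.

Lemma dim_ge_independent W : independent e W -> exists Ps : nat -> S -> Prop,
  prime_chain Ps #|W| /\ subideal I (Ps 0%N).
Proof.
move=> hW; exists (fun i => vprime (~: W :|: set_prefix W i)); split.
  by apply: vprime_chain; rewrite disjoints_subset.
rewrite set_prefix0 setU0; apply: edge_ideal_sub_vprime => //.
by rewrite setCK.
Qed.

(** Every independent dominating W satisfies depth <= |W| <= dim, so equality of depth and dimension
    fixes |W|, and with it the height n - |W| of each minimal prime. *)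
Lemma cohen_macaulay_unmixed : cohen_macaulay I -> unmixed I.
Proof.
case=> d [[[fs [hfs hsz]] _] [_ hdim]].
suff hh P h : minimal_prime I P -> height_is P h -> h = (n - d)%N.
  by move=> P Q hP hQ mP mQ /(hh _ _ mP)-> /(hh _ _ mQ)->.
move=> /(minimal_prime_vprime he)[W [hW hdom ->]] hPh.
rewrite (height_uniq hPh (height_vprime F (~: W))).
rewrite [LHS]cardsCs setCK card_ord; congr (_ - _)%N; apply/eqP.
have [Ps [h1 h2]] := dim_ge_independent hW.
rewrite eqn_leq (hdim Ps) // -hsz; exact: edge_regular_seq_bound hfs.
Qed.

(** Unmixedness gives all independent dominating sets the size i(G), which is then the dimension;
    the symmetric polynomials form a regular sequence of that length. *)
Lemma unmixed_cohen_macaulay :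
  regular I (esyms F n (idom e)) -> unmixed I -> cohen_macaulay I.
Proof.
move=> hreg hun; exists (idom e).
have [W0 [hW0 hdom0 hc0]] := idom_attained he; split; split.
- exists (esyms F n (idom e)); split; first exact: esyms_regular_seq.
  by rewrite size_map size_iota.
- by move=> fs hfs; rewrite hc0; apply: edge_regular_seq_bound hfs.
- by rewrite hc0; apply: dim_ge_independent.
- move=> Ps l hPs h0; have [W [hW hdom hl]] := dim_le_independent hPs h0.
  have := hun _ _ _ _ (vprime_minimal F he hW hdom)
    (vprime_minimal F he hW0 hdom0) (height_vprime F _) (height_vprime F _).
  have := cardsC W; have := cardsC W0; rewrite hc0; lia.
Qed.

End EdgeIdealInvariants.

Local Close Scope ring_scope.

Theorem theorem5p1
  (F : fieldType)
  (f : forall n : nat, rel 'I_n -> nat)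
  (Hf : f = gamma \/ f = idom)
  (C : forall n : nat, rel 'I_n -> Prop)
  (Hher : forall (n : nat) (e : rel 'I_n.+1) (v : 'I_n.+1),
      simple_graph e -> C n.+1 e -> C n (del_vertex e v))
  (Hdel : forall (n : nat) (e : rel 'I_n.+1),
      simple_graph e -> C n.+1 e -> has_edge e ->
      exists v : 'I_n.+1, (f n.+1 e <= f n (del_vertex e v))%N) :
  forall (n : nat) (e : rel 'I_n), simple_graph e -> C n e ->
    (exists d, is_pd (@edge_ideal F n e) d /\ (d <= n - f n e)%N) /\
    (f = idom ->
       is_pd (@edge_ideal F n e) (n - idom e) /\
       bight_is (@edge_ideal F n e) (n - idom e) /\
       (cohen_macaulay (@edge_ideal F n e) <-> unmixed (@edge_ideal F n e))).
Proof.
move=> n e he hC.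
have hres : has_free_res (@edge_ideal F n e) (n - f n e).
  apply: pdJ_le_has_free_res.
  apply: (domination_induction Hf Hher Hdel
    (Phi := fun J r => pdJ_le r J)) => //.
  - by move=> J r r'; apply: pdJ_leW.
  - exact: pdJ_le_vprime.
  - by move=> D i r hD; apply: pdJ_le_colon; apply: sqfree_ideal.
split.
  by have [d [h1 h2 h3]] := ex_least hres; exists d.
move=> Ef; split; [|split].
- split; first by rewrite Ef in hres.
  move=> r hr; have [W [hW hdom ->]] := idom_attained he.
  exact: free_res_bound hr.
- exact: bight_edge_ideal.
split; first exact: cohen_macaulay_unmixed.
apply: unmixed_cohen_macaulay => //.
(* The induction yields the bound r = n - f, and the sequence attached to r has length n - r; f <= n
   makes this f again. *)
have -> : idom e = n - (n - f n e).
  by rewrite subKn ?Ef //; rewrite -Ef; apply: domination_le.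
apply: (domination_induction Hf Hher Hdel
  (Phi := fun J r => regular J (esyms F n (n - r)))) => //.
- move=> J r r' hr; have [fs ->] := esyms_cat F n (leq_sub2l n hr).
  exact: regular_cat.
- move=> T; apply: esyms_regular; rewrite subnK //.
  by rewrite -[X in _ <= X]card_ord max_card.
- by move=> D i r hD; apply: regular_from_colon; apply: sqfree_ideal.
Qed.
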